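(* Let $G$ be a discrete group, $\omega_0$ a normalized $\mathbb{C}$-valued $2$-cocycle on $G$, and $x\in G$ an element with finite centralizer $C_G(x)$. Let $A$ be a unital $G$-graded $\mathbb{C}$-algebra, let $\phi$ be a cyclic cocycle on $A$ supported on the conjugacy class of $x$, and for $t\in I=[0,1]$ let $\phi^{(t)}$ be the induced cyclic cocycle on $A_{\omega^t}$ defined using the function $\xi$ given in the context. If $c$ is a $(b-B)$-cocycle in $\bar C_*(\Gamma^\infty(I;A_{\omega^*}))$, then the pairing $\langle \phi^{(t)},\mathrm{ev}_t c\rangle$ is independent of $t$.
   Context: Normalized $2$-cocycle: $\omega_0:G\times G\to\mathbb{C}$ with $\omega_0(h,k)+\omega_0(g,hk)=\omega_0(g,h)+\omega_0(gh,k)$, $\omega_0(e,g)=\omega_0(g,e)=0$ and $\omega_0(g,g^{-1})=0$. Put $\omega^t(g,h)=e^{t\omega_0(g,h)}$ and $\omega_0^a(g,h)=\omega_0(g,h)-\omega_0(h,g)$. $\mathrm{Ad}_G(x)$ is the conjugacy class of $x$; for each $y\in \mathrm{Ad}_G(x)$ fix $g^y\in G$ with $(g^y)^{-1}xg^y=y$. Function $\xi$: let $\psi(g)=\frac{1}{|C_G(x)|}\sum_{h\in C_G(x)}\omega_0(h,g)$ for $g\in C_G(x)$; set $\xi(g_0)=\psi(x)+\omega_0^a(g^{g_0}g_0,(g^{g_0})^{-1})$ for $g_0\in\mathrm{Ad}_G(x)$ and $\xi(g_0)=0$ otherwise. A $G$-graded algebra is $A=\bigoplus_{g\in G}A_g$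 with $1\in A_e$, $A_gA_h\subset A_{gh}$. $A_{\omega^t}$ is the space $A$ with product $a*_tb=\omega^t(g,h)ab$ for $a\in A_g$, $b\in A_h$. Chains: for a unital algebra $R$, $\bar C_n(R)=R\otimes(R/\mathbb{C}1)^{\otimes n}$, with $b(a_0\otimes\cdots\otimes a_n)=\sum_{i=0}^{n-1}(-1)^ia_0\otimes\cdots\otimes a_ia_{i+1}\otimes\cdots\otimes a_n+(-1)^na_na_0\otimes a_1\otimes\cdots\otimes a_{n-1}$ and $B(a_0\otimes\cdots\otimes a_n)=\sum_{i=0}^n(-1)^{ni}\,1\otimes a_i\otimes\cdots\otimes a_n\otimes a_0\otimes\cdots\otimes a_{i-1}$. A $(b-B)$-cocycle $c$ is a family $(c_k)$, $c_k\in\bar C_k(R)$, with $(b-B)c=0$, i.e. $bc_{k+2}=Bc_k$ (and $bc_1=0$). A cyclic $n$-cocycle is a functional $\phi$ on $\bar C_n(A)$ with $\phi\circ b=0$ and $\phi(a_n,a_0,\dots,a_{n-1})=(-1)^n\phi(a_0,\dots,a_n)$; it pairs with $c$ via the component $c_n$. It is supported on the conjugacy class of $x$ if $\phi(a_0,\dots,a_n)=0$ for homogeneous $a_i\in A_{g_i}$ with $g_0\cdots g_n\notin\mathrm{Ad}_G(x)$. For homogeneous $a_i\in A_{g_i}$ with $g_0\cdots g_n\in\mathrm{Ad}_G(x)$, $$\phi^{(t)}(a_0,\dots,a_n)=\omega^t(g_0,g_1)\,\omega^t(g_0g_1,g_2)\cdots\omega^t(g_0\cdots g_{n-1},g_n)\,e^{t\xi(g_0\cdots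 g_n)}\phi(a_0,\dots,a_n),$$ and $\phi^{(t)}$ vanishes on other homogeneous tuples. $\Gamma^\infty(I;A_{\omega^*})$ is the union, over finite dimensional subspaces $V\subset A$, of the smooth functions $I\to V$, with pointwise product $(f*f')(t)=f(t)*_tf'(t)$; $\mathrm{ev}_t:\Gamma^\infty(I;A_{\omega^*})\to A_{\omega^t}$ is evaluation, extended to chains. *)

(* Defs.v *)
From HB Require Import structures.
From mathcomp Require Import all_boot all_order all_algebra.
From mathcomp Require Import finmap complex.
From mathcomp Require Import all_classical all_reals all_analysis.
From mathcomp Require Import ring.

Set Implicit Arguments.
Unset Strict Implicit.
Unset Printing Implicit Defensive.

Import Order.TTheory GRing.Theory Num.Theory.
Import numFieldNormedType.Exports.

Local Open Scope classical_set_scope.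
Local Open Scope ring_scope.
Local Open Scope complex_scope.

Section Exponential.
Variable R : realType.
Implicit Types (z w : R[i]).

Definition cexp z : R[i] :=
  (expR (complex.Re z))%:C * (cos (complex.Im z) +i* sin (complex.Im z)).

Lemma cexp0 : cexp 0 = 1.
Proof. by rewrite /cexp /= expR0 cos0 sin0; apply/eqP; rewrite eq_complex /=; apply/andP; split; apply/eqP; ring. Qed.

Lemma cexpD z w : cexp (z + w) = cexp z * cexp w.
Proof.
case: z => a b; case: w => c d; rewrite /cexp /= expRD cosD sinD.
by apply/eqP; rewrite eq_complex /=; apply/andP; split; apply/eqP; ring.
Qed.

End Exponential.

Section Smooth.
Variable R : realType.
Implicit Types (u v : R -> R) (n : nat).

Definition smooth u : Prop := forall n x, derivable (derive1n n u) x 1.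

Lemma smoothS u :
  smooth u <-> (forall x, derivable u x 1) /\ smooth (u^`()%classic).
Proof.
split=> [su|[u0 su] [|n] x]; last by rewrite derive1Sn.
- by split=> [x|n x]; [exact: (su 0%N) | rewrite -derive1Sn].
- exact: u0.
Qed.

Fixpoint derivable_upto n u : Prop :=
  if n is m.+1 then
    (forall x, derivable u x 1) /\ derivable_upto m (u^`()%classic)
  else True.

Lemma smoothP u : smooth u <-> forall n, derivable_upto n u.
Proof.
split=> [su n|+ n].
  by elim: n u su => //= n IH u /smoothS[? ?]; split=> //; apply: IH.
elim: n u => [|n IH] u du x; first by case: (du 1%N) => + _; exact.
by rewrite derive1Sn; apply: IH => m; case: (du m.+1).
Qed.

Lemma derivable_uptoW n u : derivable_upto n.+1 u -> derivable_upto n u.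
Proof. by elim: n u => // n IH u [du /IH]. Qed.

Lemma derivable_uptoD n u v :
  derivable_upto n u -> derivable_upto n v -> derivable_upto n (u + v).
Proof.
elim: n u v => // n IH u v [du Du] [dv Dv]; split=> [x|]; first exact: derivableD.
suff -> : (u + v)^`()%classic = u^`()%classic + v^`()%classic by exact: IH.
by apply/funext => x; rewrite derive1E deriveD// fctE !derive1E.
Qed.

Lemma derivable_uptoM n u v :
  derivable_upto n u -> derivable_upto n v -> derivable_upto n (u * v).
Proof.
elim: n u v => // n IH u v [du Du] [dv Dv]; split=> [x|]; first exact: derivableM.
suff -> : (u * v)^`()%classic = u * v^`()%classic + v * u^`()%classic.
  by apply: derivable_uptoD; apply: IH => //; apply: derivable_uptoW; split.
by apply/funext => x; rewrite derive1E deriveM// !fctE !derive1E.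
Qed.

Lemma smoothD u v : smooth u -> smooth v -> smooth (u + v).
Proof. by move=> /smoothP su /smoothP sv; apply/smoothP => n; apply: derivable_uptoD. Qed.

Lemma smoothM u v : smooth u -> smooth v -> smooth (u * v).
Proof. by move=> /smoothP su /smoothP sv; apply/smoothP => n; apply: derivable_uptoM. Qed.

Lemma smooth_cst (a : R) : smooth (cst a).
Proof.
apply/smoothP => n; elim: n a => //= n IH a; split; first by move=> x; exact: derivable_cst.
suff -> : (cst a)^`()%classic = cst 0 :> (R -> R) by exact: IH.
by apply/funext => x; rewrite derive1E derive_cst.
Qed.

Lemma smooth_exp_trig (a b p q : R) :
  smooth (fun x => expR (x * a) * (p * cos (x * b) + q * sin (x * b))).
Proof.
apply/smoothP => n; elim: n p q => //= n IH p q.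
set f := fun x => _.
have df (x : R) : is_derive x 1 (f : R -> R)
    (expR (x * a) * ((a * p + b * q) * cos (x * b)
                     + (a * q - b * p) * sin (x * b))).
  have da (c : R) : is_derive x 1 (fun y : R => y * c) c.
    apply: is_derive_eq.
    rewrite /GRing.scale /=; ring.
  have de : is_derive x 1 (fun y : R => expR (y * a)) (expR (x * a) * a).
    by apply: (is_derive1_comp (f := @expR R) (g := fun y => y * a)).
  have dc : is_derive x 1 (fun y : R => cos (y * b)) (- sin (x * b) * b).
    by apply: (is_derive1_comp (f := @cos R) (g := fun y => y * b)).
  have ds : is_derive x 1 (fun y : R => sin (y * b)) (cos (x * b) * b).
    by apply: (is_derive1_comp (f := @sin R) (g := fun y => y * b)).
  rewrite /f; apply: is_derive_eq; rewrite /GRing.scale /=; ring.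
split=> [x|]; first by have [] := df x.
suff -> : f^`()%classic = (fun x => expR (x * a) *
   ((a * p + b * q) * cos (x * b) + (a * q - b * p) * sin (x * b))) by exact: IH.
by apply/funext => x; rewrite derive1E (@derive_val _ _ _ _ _ _ _ (df x)).
Qed.

Definition unit_interval := {t : R | 0 <= t <= 1}.

(* Smoothness on the closed interval: restriction of a smooth function on the
   line, for the real and the imaginary part. *)
Definition smooth_on_I (c : unit_interval -> R[i]) :=
  exists u v : R -> R,
    [/\ smooth u, smooth v & forall t, c t = u (val t) +i* v (val t)].

Lemma smooth_on_I_cst (z : R[i]) : smooth_on_I (fun=> z).
Proof.
exists (cst (complex.Re z)), (cst (complex.Im z)).
by split=> [||t]; [exact: smooth_cst | exact: smooth_cst | case: z].
Qed.

Lemma smooth_on_IM c d :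
  smooth_on_I c -> smooth_on_I d -> smooth_on_I (fun t => c t * d t).
Proof.
move=> [u [v [su sv cE]]] [u' [v' [su' sv' dE]]].
exists (u * u' + cst (-1) * (v * v')), (u * v' + v * u').
have sN := @smooth_cst (-1).
split=> [||t].
- exact: (smoothD (smoothM su su') (smoothM sN (smoothM sv sv'))).
- exact: (smoothD (smoothM su sv') (smoothM sv su')).
rewrite cE dE !fctE; apply/eqP; rewrite eq_complex /=; apply/andP.
by split; apply/eqP; ring.
Qed.

Lemma smooth_on_I_cexp (z : R[i]) :
  smooth_on_I (fun t => cexp ((val t)%:C * z)).
Proof.
case: z => a b.
exists (fun x => expR (x * a) * (1 * cos (x * b) + 0 * sin (x * b))).
exists (fun x => expR (x * a) * (0 * cos (x * b) + 1 * sin (x * b))).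
split=> [||[t tI]]; do ?exact: smooth_exp_trig.
by apply/eqP; rewrite eq_complex /cexp; simpc.
Qed.

End Smooth.

Section FiniteSupportSums.
Variables (I : choiceType) (M : zmodType).

Lemma fsumE (F : I -> M) (s : seq I) : uniq s ->
  (forall i, i \notin s -> F i = 0) -> \sum_(i \in [set: I]) F i = \sum_(i <- s) F i.
Proof.
move=> us Fs; rewrite [RHS]fsbig_seq//; apply/esym.
apply: fsbig_widen => // i /= [_ /negP si]; exact: Fs.
Qed.

Lemma finite_support_seq (F : I -> M) : finite_set [set i | F i != 0] ->
  exists2 s : seq I, uniq s & forall i, i \notin s -> F i = 0.
Proof.
move=> fF; have [s sE] := iffLR (finite_seqP _) fF; exists (undup s) => [|i]; first exact: undup_uniq.
rewrite mem_undup => si; apply/eqP; apply: contraNT si => Fi.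
by have : [set i | F i != 0] i by []; rewrite sE.
Qed.

End FiniteSupportSums.

Section Graded.
Variables (R : realType) (G : groupType) (A : algType R[i]).

Record is_grading (A_ : G -> set A) : Prop := IsGrading {
  grading0 : forall g, A_ g 0;
  gradingP : forall g (k : R[i]) a b, A_ g a -> A_ g b -> A_ g (k *: a + b);
  grading_decomp : forall a, exists! a_ : G -> A,
    [/\ forall g, A_ g (a_ g), finite_set [set g | a_ g != 0]
      & a = \sum_(g \in [set: G]) a_ g];
  grading1 : A_ 1%g 1;
  gradingM : forall g h a b, A_ g a -> A_ h b -> A_ (g * h)%g (a * b) }.

Record grading := Grading {
  grading_fun :> G -> set A;
  grading_axiom : is_grading grading_fun }.

Variable gr : grading.
Implicit Types (a b : A) (g h : G).

Definition comp a : G -> A := sval (cid (grading_decomp (grading_axiom gr) a)).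

Lemma comp_in a g : gr g (comp a g).
Proof. by rewrite /comp; case: cid => f [[]]. Qed.

Lemma comp_sum a : a = \sum_(g \in [set: G]) comp a g.
Proof. by rewrite /comp; case: cid => f [[]]. Qed.

Lemma comp_finite a : finite_set [set g | comp a g != 0].
Proof. by rewrite /comp; case: cid => f [[]]. Qed.

Lemma comp_uniq a (f : G -> A) : (forall g, gr g (f g)) ->
  finite_set [set g | f g != 0] -> a = \sum_(g \in [set: G]) f g -> comp a = f.
Proof. by move=> fi ff fE; rewrite /comp; case: cid => f' /= [_ fu]; apply: fu. Qed.

Lemma comp_seq a b : exists s : seq G, [/\ uniq s,
  forall g, g \notin s -> comp a g = 0 & forall g, g \notin s -> comp b g = 0].
Proof.
have [s us sa] := finite_support_seq (comp_finite a).
have [s' us' sb] := finite_support_seq (comp_finite b).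
exists (undup (s ++ s')); split=> [|g|g]; rewrite ?undup_uniq// mem_undup mem_cat.
  by move=> /norP[/sa].
by move=> /norP[_ /sb].
Qed.

Lemma compP (k : R[i]) a b g : comp (k *: a + b) g = k *: comp a g + comp b g.
Proof.
have [s [us sa sb]] := comp_seq a b.
rewrite (@comp_uniq _ (fun g => k *: comp a g + comp b g))//.
- by move=> h; apply: (gradingP (grading_axiom gr)); exact: comp_in.
- apply: (@sub_finite_set _ _ [set` s]); last exact: finite_seq.
  by move=> h /=; apply: contraR => hs; rewrite sa// sb// scaler0 addr0.
- rewrite {1}(comp_sum a) {1}(comp_sum b) !(fsumE us)//.
    by rewrite big_split/= -scaler_sumr.
  by move=> h hs; rewrite sa// sb// scaler0 addr0.
Qed.

Lemma comp0 g : comp 0 g = 0.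
Proof. by have := compP (-1) 0 0 g; rewrite scaler0 addr0 scaleN1r addNr. Qed.

Lemma compD a b g : comp (a + b) g = comp a g + comp b g.
Proof. by have := compP 1 a b g; rewrite !scale1r. Qed.

Lemma compZ k a g : comp (k *: a) g = k *: comp a g.
Proof. by have := compP k a 0 g; rewrite comp0 !addr0. Qed.

Lemma comp_homog g a : gr g a -> comp a = fun h => if h == g then a else 0.
Proof.
move=> ga; apply: comp_uniq.
- by move=> h; case: eqP => [->//|_]; exact: grading0 (grading_axiom gr) h.
- apply: (@sub_finite_set _ _ [set g]); last exact: finite_set1.
  by move=> h /=; case: (eqVneq h g) => // _; rewrite eqxx.
- rewrite (@fsumE _ _ _ [:: g])// ?big_seq1 ?eqxx// => h.
  by rewrite inE => /negbTE ->.
Qed.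

Lemma homog_ind (P : A -> Prop) : P 0 -> (forall a b, P a -> P b -> P (a + b)) ->
  (forall g a, gr g a -> P a) -> forall a, P a.
Proof.
move=> P0 PD Ph a; have [s us sa] := finite_support_seq (comp_finite a).
rewrite (comp_sum a) (fsumE us)//; elim/big_ind: _ => // g _.
exact: Ph (comp_in a g).
Qed.

End Graded.

Section Cocycle.
Variables (R : realType) (G : groupType).

Record is_normalized_cocycle (w : G -> G -> R[i]) : Prop := IsNormalizedCocycle {
  cocycleP : forall g h k, w h k + w g (h * k)%g = w g h + w (g * h)%g k;
  cocycle1g : forall g, w 1%g g = 0;
  cocycleg1 : forall g, w g 1%g = 0;
  cocycleV : forall g, w g (g^-1)%g = 0 }.

Record normalized_cocycle := NormalizedCocycle {
  cocycle_fun :> G -> G -> R[i];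
  cocycle_axiom : is_normalized_cocycle cocycle_fun }.

Definition cocycle_exp (w : normalized_cocycle) (t : R) (g h : G) : R[i] :=
  cexp (t%:C * w g h).

Lemma cocycle_expM w t g h k : cocycle_exp w t h k * cocycle_exp w t g (h * k)%g
  = cocycle_exp w t g h * cocycle_exp w t (g * h)%g k.
Proof.
rewrite /cocycle_exp -cexpD -mulrDr (cocycleP (cocycle_axiom w)).
by rewrite mulrDr cexpD.
Qed.

Definition cocycle_alt (w : normalized_cocycle) (g h : G) : R[i] := w g h - w h g.

End Cocycle.

(* The arguments gr, w and t select the product put on the space A. *)
Definition twisted (R : realType) (G : groupType) (A : algType R[i])
  (gr : grading G A) (w : normalized_cocycle R G) (t : R) : Type := A.

Section Twisted.
Variables (R : realType) (G : groupType) (A : algType R[i]).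
Variables (gr : grading G A) (w : normalized_cocycle R G) (t : R).
Implicit Types (a b c : A) (g h : G).

Definition twisted_mul a b : A :=
  \sum_(g \in [set: G]) \sum_(h \in [set: G])
    cocycle_exp w t g h *: (comp gr a g * comp gr b h).

Lemma twisted_mulE a b (s s' : seq G) : uniq s -> uniq s' ->
  (forall g, g \notin s -> comp gr a g = 0) ->
  (forall g, g \notin s' -> comp gr b g = 0) ->
  twisted_mul a b = \sum_(g <- s) \sum_(h <- s')
    cocycle_exp w t g h *: (comp gr a g * comp gr b h).
Proof.
move=> us us' sa sb; rewrite /twisted_mul (fsumE us).
  apply: eq_bigr => g _; rewrite (fsumE us')// => h hs.
  by rewrite sb// mulr0 scaler0.
by move=> g gs; rewrite (@fsumE _ _ _ [::])// ?big_nil// => h _; rewrite sa// mul0r scaler0.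
Qed.

Lemma twisted_mul_homog g h a b : gr g a -> gr h b ->
  twisted_mul a b = cocycle_exp w t g h *: (a * b).
Proof.
move=> ga hb; rewrite (@twisted_mulE _ _ [:: g] [:: h])//; last 2 first.
- by move=> k; rewrite inE (comp_homog ga) => /negbTE ->.
- by move=> k; rewrite inE (comp_homog hb) => /negbTE ->.
by rewrite !big_seq1 (comp_homog ga) (comp_homog hb) !eqxx.
Qed.

Lemma twisted_mulPl (k : R[i]) a b c :
  twisted_mul (k *: a + b) c = k *: twisted_mul a c + twisted_mul b c.
Proof.
have [s [us sa sb]] := comp_seq gr a b; have [s' [us' sc _]] := comp_seq gr c c.
rewrite !(@twisted_mulE _ _ s s')//; last first.
  by move=> g gs; rewrite compP sa// sb// scaler0 addr0.
rewrite scaler_sumr -big_split/=; apply: eq_bigr => g _.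
rewrite scaler_sumr -big_split/=; apply: eq_bigr => h _.
by rewrite compP mulrDl -scalerAl scalerDr !scalerA mulrC.
Qed.

Lemma twisted_mulPr (k : R[i]) a b c :
  twisted_mul c (k *: a + b) = k *: twisted_mul c a + twisted_mul c b.
Proof.
have [s [us sa sb]] := comp_seq gr a b; have [s' [us' sc _]] := comp_seq gr c c.
rewrite !(@twisted_mulE _ _ s' s)//; last first.
  by move=> g gs; rewrite compP sa// sb// scaler0 addr0.
rewrite scaler_sumr -big_split/=; apply: eq_bigr => g _.
rewrite scaler_sumr -big_split/=; apply: eq_bigr => h _.
by rewrite compP mulrDr -scalerAr scalerDr !scalerA mulrC.
Qed.

Lemma twisted_mulDl : left_distributive twisted_mul +%R.
Proof. by move=> a b c; have := twisted_mulPl 1 a b c; rewrite !scale1r. Qed.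

Lemma twisted_mulDr : right_distributive twisted_mul +%R.
Proof. by move=> a b c; have := twisted_mulPr 1 b c a; rewrite !scale1r. Qed.

Lemma twisted_mul0l a : twisted_mul 0 a = 0.
Proof. by have := twisted_mulPl (-1) 0 0 a; rewrite scaler0 addr0 scaleN1r addNr. Qed.

Lemma twisted_mul0r a : twisted_mul a 0 = 0.
Proof. by have := twisted_mulPr (-1) 0 0 a; rewrite scaler0 addr0 scaleN1r addNr. Qed.

Lemma twisted_mulZl (k : R[i]) a b :
  k *: twisted_mul a b = twisted_mul (k *: a) b.
Proof. by have := twisted_mulPl k a 0 b; rewrite twisted_mul0l !addr0. Qed.

Lemma twisted_mulZr (k : R[i]) a b :
  k *: twisted_mul a b = twisted_mul a (k *: b).
Proof. by have := twisted_mulPr k b 0 a; rewrite twisted_mul0r !addr0. Qed.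

Lemma twisted_mul1l : left_id 1 twisted_mul.
Proof.
elim/(homog_ind (gr := gr)) => [|a b IHa IHb|g a ga]; first exact: twisted_mul0r.
  by rewrite twisted_mulDr IHa IHb.
rewrite (twisted_mul_homog (grading1 (grading_axiom gr)) ga).
by rewrite /cocycle_exp (cocycle1g (cocycle_axiom w)) mulr0 cexp0 scale1r mul1r.
Qed.

Lemma twisted_mul1r : right_id 1 twisted_mul.
Proof.
elim/(homog_ind (gr := gr)) => [|a b IHa IHb|g a ga]; first exact: twisted_mul0l.
  by rewrite twisted_mulDl IHa IHb.
rewrite (twisted_mul_homog ga (grading1 (grading_axiom gr))).
by rewrite /cocycle_exp (cocycleg1 (cocycle_axiom w)) mulr0 cexp0 scale1r mulr1.
Qed.

Lemma twisted_mulA : associative twisted_mul.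
Proof.
move=> a b c.
elim/(homog_ind (gr := gr)): a => [|a a' IH IH'|g a ga].
- by rewrite !twisted_mul0l.
- by rewrite !twisted_mulDl IH IH'.
elim/(homog_ind (gr := gr)): b => [|b b' IH IH'|h b hb].
- by rewrite !(twisted_mul0l, twisted_mul0r).
- by rewrite !(twisted_mulDl, twisted_mulDr) IH IH'.
elim/(homog_ind (gr := gr)): c => [|c c' IH IH'|k c kc].
- by rewrite !twisted_mul0r.
- by rewrite !twisted_mulDr IH IH'.
have M := gradingM (grading_axiom gr).
rewrite (twisted_mul_homog hb kc) (twisted_mul_homog ga hb).
rewrite -twisted_mulZl -twisted_mulZr.
rewrite (twisted_mul_homog ga (M _ _ _ _ hb kc)).
rewrite (twisted_mul_homog (M _ _ _ _ ga hb) kc).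
by rewrite !scalerA cocycle_expM [a * (b * c)]mulrA.
Qed.

Local Notation At := (twisted gr w t).

HB.instance Definition _ := GRing.Lmodule.copy At A.
HB.instance Definition _ := GRing.Zmodule_isNzRing.Build At
  twisted_mulA twisted_mul1l twisted_mul1r twisted_mulDl twisted_mulDr
  (oner_neq0 A).
HB.instance Definition _ := GRing.Lmodule_isLalgebra.Build R[i] At
  twisted_mulZl.
HB.instance Definition _ := GRing.Lalgebra_isAlgebra.Build R[i] At
  twisted_mulZr.

End Twisted.

Definition sections (R : realType) (G : groupType) (A : algType R[i])
  (gr : grading G A) (w : normalized_cocycle R G) : Type := unit_interval R -> A.

Section SmoothSections.
Variables (R : realType) (G : groupType) (A : algType R[i]).
Variables (gr : grading G A) (w : normalized_cocycle R G).
Local Notation I := (unit_interval R).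
Local Notation At t := (twisted gr w (val t)).

Local Notation sections := (sections gr w).

Definition sections_mul (f f' : sections) : sections :=
  fun t => (f t : At t) * (f' t : At t).

Lemma sections_mulA : associative sections_mul.
Proof. by move=> f g h; apply/funext => t; exact: (mulrA (f t : At t)). Qed.

Lemma sections_mul1l : left_id (cst 1 : sections) sections_mul.
Proof. by move=> f; apply/funext => t; exact: (mul1r (f t : At t)). Qed.

Lemma sections_mul1r : right_id (cst 1 : sections) sections_mul.
Proof. by move=> f; apply/funext => t; exact: (mulr1 (f t : At t)). Qed.

HB.instance Definition _ := GRing.Lmodule.copy sections (I -> A).

Lemma sections_mulDl : left_distributive sections_mul +%R.
Proof. by move=> f g h; apply/funext => t; exact: (mulrDl (f t : At t)). Qed.

Lemma sections_mulDr : right_distributive sections_mul +%R.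
Proof. by move=> f g h; apply/funext => t; exact: (mulrDr (f t : At t)). Qed.

Lemma sections_mulZl (k : R[i]) (f g : sections) :
  k *: sections_mul f g = sections_mul (k *: f) g.
Proof. by apply/funext => t; exact: (scalerAl k (f t : At t)). Qed.

Lemma sections_mulZr (k : R[i]) (f g : sections) :
  k *: sections_mul f g = sections_mul f (k *: g).
Proof. by apply/funext => t; exact: (scalerAr k (f t : At t)). Qed.

Lemma sections1_neq0 : (cst 1 : sections) != 0.
Proof.
apply/eqP => /(congr1 (fun f : sections => f (exist _ 0 _))) => /(_ _)/eqP.
have h : 0 <= (0 : R) <= 1 by rewrite lexx ler01.
by move=> /(_ h); rewrite (negbTE (oner_neq0 A)).
Qed.

HB.instance Definition _ := GRing.Zmodule_isNzRing.Build sections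
  sections_mulA sections_mul1l sections_mul1r sections_mulDl sections_mulDr
  sections1_neq0.
HB.instance Definition _ := GRing.Lmodule_isLalgebra.Build R[i] sections
  sections_mulZl.
HB.instance Definition _ := GRing.Lalgebra_isAlgebra.Build R[i] sections
  sections_mulZr.

(* A smooth map from I to the finite dimensional subspace spanned by v. *)
Definition smooth_in_span m (v : 'I_m -> A) (f : I -> A) :=
  exists c : 'I_m -> I -> R[i],
    (forall i, smooth_on_I (c i)) /\ forall t, f t = \sum_(i < m) c i t *: v i.

Definition smooth_section : {pred sections} := fun f =>
  `[< exists m (v : 'I_m -> A), smooth_in_span v f >].

Lemma smooth_section0 : 0 \in smooth_section.
Proof.
apply/asboolP; exists 0%N, (fun=> 0), (fun _ _ => 0).
by split=> [[]//|t]; rewrite big_ord0.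
Qed.

Lemma smooth_sectionD f g :
  f \in smooth_section -> g \in smooth_section -> f + g \in smooth_section.
Proof.
move=> /asboolP[m [v [c [sc fE]]]] /asboolP[n [v' [c' [sc' gE]]]].
apply/asboolP; exists (m + n)%N,
  (fun i => match fintype.split i with inl j => v j | inr j => v' j end),
  (fun i => match fintype.split i with inl j => c j | inr j => c' j end).
split=> [i|t]; first by case: (fintype.split i).
rewrite big_split_ord/= [LHS]/GRing.add/= fE gE.
by congr (_ + _); apply: eq_bigr => i _;
  [rewrite (unsplitK (inl _ i)) | rewrite (unsplitK (inr _ i))].
Qed.

Lemma smooth_section_cst (c : I -> R[i]) (v : A) :
  smooth_on_I c -> ((fun t => c t *: v) : sections) \in smooth_section.
Proof.
move=> sc; apply/asboolP; exists 1%N, (fun=> v), (fun=> c).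
by split=> // t; rewrite big_ord1.
Qed.

Lemma smooth_section_sum (J : Type) (s : seq J) (P : pred J) (F : J -> sections) :
  (forall j, P j -> F j \in smooth_section) ->
  \sum_(j <- s | P j) F j \in smooth_section.
Proof. by move=> sF; elim/big_ind: _ => //; [exact: smooth_section0 | exact: smooth_sectionD]. Qed.

Lemma sum_sectionsE (J : Type) (s : seq J) (P : pred J) (F : J -> sections) t :
  (\sum_(j <- s | P j) F j) t = \sum_(j <- s | P j) F j t.
Proof. by elim/big_rec2: _ => // j a b _ <-. Qed.

Lemma smooth_section_ind (P : sections -> Prop) :
  P 0 -> (forall f g, P f -> P g -> P (f + g)) ->
  (forall c v, smooth_on_I c -> P (fun t => c t *: v)) ->
  forall f, f \in smooth_section -> P f.
Proof.
move=> P0 PD Pc f /asboolP[m [v [c [sc fE]]]].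
have -> : f = \sum_(i < m) ((fun t => c i t *: v i) : sections).
  by apply/funext => t; rewrite fE sum_sectionsE.
by elim/big_ind: _ => // i _; exact: Pc.
Qed.

Lemma smooth_sectionM f g :
  f \in smooth_section -> g \in smooth_section -> f * g \in smooth_section.
Proof.
move=> sf sg; move: f sf; apply: smooth_section_ind => [|f f' IH IH'|c v sc].
- by rewrite mul0r smooth_section0.
- by rewrite mulrDl; exact: smooth_sectionD.
move: g sg; apply: smooth_section_ind => [|f f' IH IH'|c' v' sc'].
- by rewrite mulr0 smooth_section0.
- by rewrite mulrDr; exact: smooth_sectionD.
have [s [us sv sv']] := comp_seq gr v v'.
have -> : ((fun t => c t *: v) : sections) * ((fun t => c' t *: v') : sections)
  = \sum_(g <- s) \sum_(h <- s) ((fun t => c t * c' t * cocycle_exp w (val t) g h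
      *: (comp gr v g * comp gr v' h)) : sections).
  apply/funext => t; rewrite sum_sectionsE.
  under eq_bigr do rewrite sum_sectionsE.
  transitivity (twisted_mul gr w (val t) (c t *: v) (c' t *: v')); first by [].
  rewrite -twisted_mulZl -twisted_mulZr scalerA (twisted_mulE w (val t) us us)//.
  rewrite scaler_sumr; apply: eq_bigr => g _.
  by rewrite scaler_sumr; apply: eq_bigr => h _; rewrite scalerA.
apply: smooth_section_sum => g _; apply: smooth_section_sum => h _.
apply: smooth_section_cst; apply: smooth_on_IM; last exact: smooth_on_I_cexp.
exact: smooth_on_IM.
Qed.

Lemma smooth_section_subalg : subalg_closed smooth_section.
Proof.
split=> [|k f g sf sg|]; last exact: smooth_sectionM.
  have -> : 1 = (fun t => 1 *: 1) :> sections.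
    by apply/funext => t; rewrite scale1r.
  by apply: smooth_section_cst; exact: smooth_on_I_cst.
apply: smooth_sectionD => //; move: f sf.
apply: smooth_section_ind => [|f f' IH IH'|c v sc].
- by rewrite scaler0 smooth_section0.
- by rewrite scalerDr smooth_sectionD.
have -> : k *: ((fun t => c t *: v) : sections) = (fun t => (k * c t) *: v).
  by apply/funext => t; rewrite -scalerA.
apply: smooth_section_cst; apply: smooth_on_IM => //; exact: smooth_on_I_cst.
Qed.

HB.instance Definition _ := GRing.isSubalgClosed.Build R[i] sections smooth_section
  (GRing.subalg_closed_semi smooth_section_subalg).

Record smooth_sections := SmoothSections {
  section_fun :> sections;
  section_smooth : section_fun \in smooth_section }.

HB.instance Definition _ := [isSub for section_fun].
HB.instance Definition _ := [Choice of smooth_sections by <:].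
HB.instance Definition _ := [SubChoice_isSubAlgebra of smooth_sections by <:].

Definition ev (t : I) (f : smooth_sections) : At t := section_fun f t.

Lemma evP t (k : R[i]) f g : ev t (k *: f + g) = k *: ev t f + ev t g.
Proof. by []. Qed.

Lemma evM t f g : ev t (f * g) = ev t f * ev t g.
Proof. by []. Qed.

Lemma ev1 t : ev t 1 = 1.
Proof. by []. Qed.

End SmoothSections.

Section Chains.
Variables (K : fieldType) (V : algType K).
Implicit Types (n : nat).

(* A formal linear combination of elementary tensors a_0 ⊗ ... ⊗ a_n; it
   represents an element of V ⊗ (V / K 1)^⊗n, two representatives being equal
   there iff they are related by chain_eq below. *)
Definition chain n := seq (K * n.+1.-tuple V).

Definition subst_tuple n (x : n.+1.-tuple V) (i : 'I_n.+1) (a : V) : n.+1.-tuple V :=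
  [tuple if j == i then a else tnth x j | j < n.+1].

(* Generators and relations of the K-vector space V ⊗ (V / K 1)^⊗n: the first
   seven clauses give the vector space freely generated by tuples, the next two
   give multilinearity, the last one kills 1 in positions 1, ..., n. *)
Inductive chain_eq n : chain n -> chain n -> Prop :=
| chain_refl c : chain_eq c c
| chain_sym c d : chain_eq c d -> chain_eq d c
| chain_trans c d e : chain_eq c d -> chain_eq d e -> chain_eq c e
| chain_cat c c' d d' :
    chain_eq c c' -> chain_eq d d' -> chain_eq (c ++ d) (c' ++ d')
| chain_comm c d : chain_eq (c ++ d) (d ++ c)
| chain_zero x : chain_eq [:: (0, x)] [::]
| chain_add k l x : chain_eq [:: (k, x); (l, x)] [:: (k + l, x)]
| chain_tensorD k x i a b :
    chain_eq [:: (k, subst_tuple x i (a + b))]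
             [:: (k, subst_tuple x i a); (k, subst_tuple x i b)]
| chain_tensorZ k l x i a :
    chain_eq [:: (k, subst_tuple x i (l *: a))] [:: (k * l, subst_tuple x i a)]
| chain_degenerate k x (i : 'I_n.+1) :
    i != ord0 -> tnth x i = 1 -> chain_eq [:: (k, x)] [::].

(* A functional on V ⊗ (V / K 1)^⊗n is a multilinear map killing the tuples
   with a 1 in some position 1, ..., n. *)
Record is_cochain n (phi : n.+1.-tuple V -> K) : Prop := IsCochain {
  cochainP : forall k x i a b, phi (subst_tuple x i (k *: a + b))
    = k * phi (subst_tuple x i a) + phi (subst_tuple x i b);
  cochain_degenerate : forall x (i : 'I_n.+1),
    i != ord0 -> tnth x i = 1 -> phi x = 0 }.

Definition pairing n (phi : n.+1.-tuple V -> K) (c : chain n) : K :=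
  \sum_(p <- c) p.1 * phi p.2.

Lemma chain_eq_pairing n (phi : n.+1.-tuple V -> K) c d :
  is_cochain phi -> chain_eq c d -> pairing phi c = pairing phi d.
Proof.
move=> [phiP phi1]; rewrite /pairing.
elim=> {c d}[//|//|? ? ? _ -> //|c c' d d' _ IH _ IH'|c d|x|k l x|k x i a b|k l x i a|k x i i0 xi].
- by rewrite !big_cat /= IH IH'.
- by rewrite !big_cat /= addrC.
- by rewrite big_seq1 big_nil mul0r.
- by rewrite !big_cons !big_nil /= !addr0 mulrDl.
- by rewrite !big_cons !big_nil /= !addr0 -mulrDr -[a]scale1r phiP mul1r scale1r.
- rewrite !big_cons !big_nil /= !addr0 -mulrA; congr (_ * _).
  have z : phi (subst_tuple x i 0) = 0.
    by have := phiP (-1) x i 0 0; rewrite scaler0 addr0 mulN1r addNr.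
  by have := phiP l x i a 0; rewrite z !addr0.
- by rewrite big_seq1 big_nil (phi1 _ _ i0 xi) mulr0.
Qed.

Lemma cochain0 n (phi : n.+1.-tuple V -> K) x (i : 'I_n.+1) :
  is_cochain phi -> tnth x i = 0 -> phi x = 0.
Proof.
move=> [phiP _] xi; have -> : x = subst_tuple x i 0.
  by apply: eq_from_tnth => j; rewrite tnth_mktuple; case: eqP => // ->.
by have := phiP (-1) x i 0 0; rewrite scaler0 addr0 mulN1r addNr.
Qed.

Definition linext n m (f : n.+1.-tuple V -> chain m) (c : chain n) : chain m :=
  flatten [seq [seq (p.1 * q.1, q.2) | q <- f p.2] | p <- c].

(* a_0, ..., a_i a_{i+1}, ..., a_{n+1} for i <= n, and
   a_{n+1} a_0, a_1, ..., a_n for i = n+1. *)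
Definition face n (x : n.+2.-tuple V) (i : nat) : n.+1.-tuple V :=
  if (i <= n)%N then
    [tuple if (j < i)%N then x`_j else if (j == i :> nat)%N then x`_j * x`_j.+1
           else x`_j.+1 | j < n.+1]
  else [tuple if (j == 0 :> nat)%N then x`_n.+1 * x`_0 else x`_j | j < n.+1].

Definition b_tensor n (x : n.+2.-tuple V) : chain n :=
  [seq ((-1) ^+ i, face x i) | i <- iota 0 n.+2].

Definition hochschild_b n : chain n.+1 -> chain n := linext (@b_tensor n).

Definition B_tensor n (x : n.+1.-tuple V) : chain n.+1 :=
  [seq ((-1) ^+ (n * i), [tuple of 1 :: rot i x]) | i <- iota 0 n.+1].

Definition connes_B n : chain n -> chain n.+1 := linext (@B_tensor n).

Definition bB_cocycle (c : forall k, chain k) : Prop :=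
  chain_eq (hochschild_b (c 1)) [::] /\
  forall k, chain_eq (hochschild_b (c k.+2)) (connes_B (c k)).

Record is_cyclic_cocycle n (phi : n.+1.-tuple V -> K) : Prop := IsCyclicCocycle {
  cyclic_cochain : is_cochain phi;
  cyclic_closed : forall x, pairing phi (b_tensor x) = 0;
  cyclic_rot : forall x : n.+1.-tuple V, phi [tuple of rotr 1 x] = (-1) ^+ n * phi x }.

End Chains.

Section TwistedCocycle.
Variables (R : realType) (G : groupType).

Definition conj_class (x : G) : set G := [set y | exists h, y = (h^-1 * x * h)%g].

Definition centralizer (x : G) : set G := [set h | (h * x = x * h)%g].

Variables (w : normalized_cocycle R G) (x : G) (conjugator : G -> G).

Definition psi (g : G) : R[i] :=
  (#|` fset_set (centralizer x)|%:R)^-1 * \sum_(h \in centralizer x) w h g.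

Definition xi (g0 : G) : R[i] :=
  if `[< conj_class x g0 >] then
    psi x + cocycle_alt w (conjugator g0 * g0)%g ((conjugator g0)^-1)%g
  else 0.

Variables (A : algType R[i]) (gr : grading G A).

Definition supported_on_class n (phi : n.+1.-tuple A -> R[i]) : Prop :=
  forall (g : n.+1.-tuple G) (a : n.+1.-tuple A),
    (forall i, gr (tnth g i) (tnth a i)) ->
    ~ conj_class x (\prod_(h <- g) h)%g -> phi a = 0.

Definition twist_weight (t : R) n (g : n.+1.-tuple G) : R[i] :=
  (\prod_(1 <= i < n.+1)
     cocycle_exp w t (\prod_(h <- take i g) h)%g (nth 1%g g i))
  * cexp (t%:C * xi (\prod_(h <- g) h)%g).

(* The multilinear map which is twist_weight t g * phi (a) on homogeneous tuples
   of degrees g with product in the conjugacy class of x, and 0 on the others. *)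
Definition twisted_cochain (t : R) n (phi : n.+1.-tuple A -> R[i])
    (a : n.+1.-tuple (twisted gr w t)) : R[i] :=
  \sum_(g \in [set g : n.+1.-tuple G | conj_class x (\prod_(h <- g) h)%g])
    twist_weight t g * phi [tuple comp gr (tnth a i) (tnth g i) | i < n.+1].

Section Homogeneous.
Variables (t : R) (n : nat) (phi : n.+1.-tuple A -> R[i]).
Variables (g : n.+1.-tuple G) (a : n.+1.-tuple (twisted gr w t)).
Hypotheses (phiP : is_cochain phi) (ga : forall i, gr (tnth g i) (tnth a i)).

Let comp_neq0 (h : n.+1.-tuple G) : h <> g ->
  phi [tuple comp gr (tnth a i) (tnth h i) | i < n.+1] = 0.
Proof.
move=> hg; have /existsP[i hi] : [exists i, tnth h i != tnth g i].
  apply: contra_notT hg => /existsPn e; apply: eq_from_tnth => i.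
  by apply/eqP/negPn/e.
by apply: (cochain0 (i := i)) => //; rewrite tnth_mktuple (comp_homog (ga i)) (negbTE hi).
Qed.

Lemma twisted_cochain_homog : conj_class x (\prod_(h <- g) h)%g ->
  twisted_cochain phi a = twist_weight t g * phi a.
Proof.
move=> gx; rewrite /twisted_cochain.
rewrite -(@fsbig_widen _ _ _ _ [set g]) ?fsbig_set1; last 2 first.
- by move=> _ ->.
- by move=> h [_ hg]; rewrite /= comp_neq0 ?mulr0.
congr (_ * phi _); apply: eq_from_tnth => i.
by rewrite tnth_mktuple (comp_homog (ga i)) eqxx.
Qed.

Lemma twisted_cochain_homog0 : ~ conj_class x (\prod_(h <- g) h)%g ->
  twisted_cochain phi a = 0.
Proof.
move=> gx; rewrite /twisted_cochain fsbig1// => h hx.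
by rewrite comp_neq0 ?mulr0// => hg; rewrite hg in hx.
Qed.

End Homogeneous.

Definition ev_chain (t : unit_interval R) n (c : chain (smooth_sections gr w) n) :
    chain (twisted gr w (val t)) n :=
  [seq (p.1, map_tuple (ev t) p.2) | p <- c].

End TwistedCocycle.

Arguments twisted_cochain {R G} w x conjugator {A} gr t {n} phi a.

(* Main.v *)
Require Import Defs.
From HB Require Import structures.
From mathcomp Require Import all_boot all_order all_algebra.
From mathcomp Require Import finmap complex.
From mathcomp Require Import all_classical all_reals all_analysis.
From mathcomp Require Import ring lra zify.
(** The cocycle w0 need not be a coboundary on G, but it becomes one when
    pulled back to the action groupoid of G on the conjugacy class Y of x.
    Y is G/C with C the finite centralizer of x, and averaging over the
    transporter {k | k^-1 x k = y}, a coset of C, gives a function mu on G x Y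
    with mu (g h) y + w0 g h = mu g y + mu h (g^-1 y g) (orbit_primitiveM).
    Its restriction to the diagonal is xi (orbit_primitive_diag).

    Consider a homogeneous tuple a of degrees g_0, ..., g_n with product in Y.
    Let y_j be the product of the degrees read cyclically from slot j on.
    Multiplying a_j by exp (t mu(g_j, y_j)) carries the faces and the cyclic
    operators over the twisted algebra to those over A (untwist_face,
    untwist_cons_rot), and these factors multiply up to the weight that defines
    phi^(t) (twist_weightE). So on sections phi^(t) o ev_t is phi applied to the
    values at t of the untwisted tuple F_0, ..., F_n, and what remains is the
    homotopy invariance of the pairing of phi along a smooth family of maps to A.

    For that, a derivation D of A would give the classical Cartan formula: the
    cochain eta = phi (a_0 D(a_1), a_2, ..., a_{n+1}) satisfies eta o b = 0, and
    eta o B is the Lie derivative of phi along D since phi is cyclic. With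
    D = d/dt and b c_{n+2} = B c_n, the derivative of the pairing is
    <eta, B c_n> = <eta, b c_{n+2}> = 0. Here D is replaced by the increment
    F_1(s) - F_1(t) between two times (transgression). This cochain is defined
    at all s, t in I, end points included, without differentiating A-valued
    maps, and both identities then hold up to O(|s - t|^2)
    (quadratic_transgression_b, quadratic_transgression_B). Hence
    <phi^(s), c> - <phi^(t), c> is O(|s - t|^2) uniformly on I, and a function
    on an interval with this property is constant (quadratic_constant). *)

Set Implicit Arguments.
Unset Strict Implicit.
Unset Printing Implicit Defensive.

Import Order.TTheory GRing.Theory Num.Theory.
Import numFieldNormedType.Exports.

Local Open Scope classical_set_scope.
Local Open Scope ring_scope.
Local Open Scope complex_scope.

(** * A primitive of the cocycle over the conjugacy class *)

Section OrbitPrimitive.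
Variables (R : realType) (G : groupType) (w : normalized_cocycle R G) (x : G).

Definition transporter (y : G) : set G := [set k | (k^-1 * x * k)%g = y].

(** The coset of the centralizer that conjugates x to y replaces the subgroup in
    the usual averaging argument, by which a 2-cocycle on a finite group is a
    coboundary. *)
Definition orbit_primitive (g y : G) : R[i] :=
  (#|` fset_set (centralizer x)|%:R)^-1 * \sum_(k \in transporter y) w k g.

(** Right multiplication by g is a bijection from the transporter of y onto that
    of g^-1 y g. This is the reindexing behind the cocycle identity below. *)
Lemma sum_transporter (y g : G) (F : G -> R[i]) :
  \sum_(k \in transporter (g^-1 * y * g)%g) F k
  = \sum_(k \in transporter y) F (k * g)%g.
Proof.
apply: reindex_fsbig; split=> [k kxy|h k _ _ /mulIg//|k kxy].
- by rewrite /transporter /= invgM -!mulgA; rewrite -[in RHS]kxy !mulgA.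
- exists (k * g^-1)%g; last by rewrite mulgVK.
  by rewrite /transporter /= invgM invgK -mulgA (mulgA x) !mulgA
    -!(mulgA g) kxy !mulgA mulgV mul1g mulgK.
Qed.

Lemma transporter_self : transporter x = centralizer x.
Proof.
apply/seteqP; split=> k; rewrite /transporter /centralizer /=.
  by move=> kx; rewrite -[in LHS]kx !mulgA mulgV mul1g.
by move=> kx; rewrite -mulgA -kx mulgA mulVg mul1g.
Qed.

Hypothesis finite_centralizer : finite_set (centralizer x).

Lemma finite_transporter (y : G) : conj_class x y -> finite_set (transporter y).
Proof.
move=> [h ->].
apply: (@sub_finite_set _ _ [set (k * h)%g | k in centralizer x]).
  move=> k kxy; exists (k * h^-1)%g; last by rewrite mulgVK.
  rewrite -transporter_self /transporter /= invgM invgK.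
  have -> : (h * k^-1 * x * (k * h^-1) = h * (k^-1 * x * k) * h^-1)%g.
    by rewrite !mulgA.
  by rewrite kxy !mulgA mulgV mul1g mulgK.
exact: finite_image.
Qed.

Lemma card_centralizer_neq0 : #|` fset_set (centralizer x)|%:R != 0 :> R[i].
Proof.
rewrite pnatr_eq0 -lt0n cardfs_gt0; apply/fset0Pn; exists 1%g.
by rewrite in_fset_set// inE /centralizer /= mul1g mulg1.
Qed.

Lemma sum1_transporter (y : G) : conj_class x y ->
  \sum_(k \in transporter y) (1 : R[i]) = #|` fset_set (centralizer x)|%:R.
Proof.
move=> [h ->]; rewrite sum_transporter transporter_self fsbig_finite//=.
by rewrite big_const_seq count_predT iter_addr addr0.
Qed.

(** Average the cocycle identity of w at (k, g, h) over k in the transporter of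
    y. The term w(kg, h) becomes an average over the transporter of g^-1 y g,
    and w(g, h), which does not depend on k, survives because the transporter
    has as many elements as the centralizer. *)
Lemma orbit_primitiveM (g h y : G) : conj_class x y ->
  orbit_primitive (g * h)%g y + w g h
  = orbit_primitive g y + orbit_primitive h (g^-1 * y * g)%g.
Proof.
move=> xy; have fT := finite_transporter xy.
have c0 := card_centralizer_neq0.
rewrite /orbit_primitive sum_transporter -mulrDr -fsbig_split//=.
apply: (mulfI c0); rewrite mulrDr !mulVKf//.
have -> : #|` fset_set (centralizer x)|%:R * w g h
    = \sum_(k \in transporter y) w g h.
  rewrite -(sum1_transporter xy) mulrC mulr_fsumr.
  by apply: eq_fsbigr => k _; rewrite mulr1.
rewrite -fsbig_split//=; apply: eq_fsbigr => k _.
by rewrite addrC; exact: (cocycleP (cocycle_axiom w)).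
Qed.

Lemma orbit_primitive1 (y : G) : orbit_primitive 1%g y = 0.
Proof.
rewrite /orbit_primitive fsbig1 ?mulr0// => k _.
exact: (cocycleg1 (cocycle_axiom w)).
Qed.

(** Conjugating gh by g gives hg: apply orbit_primitiveM at both base points and
    compare. *)
Lemma orbit_primitive_swap (g h : G) : conj_class x (g * h)%g ->
  orbit_primitive (g * h)%g (g * h)%g + cocycle_alt w g h
  = orbit_primitive (h * g)%g (h * g)%g.
Proof.
move=> xgh; have xhg : conj_class x (h * g)%g.
  have [k ghE] := xgh; exists (k * g)%g.
  by rewrite invgM -!mulgA (mulgA k^-1%g) (mulgA (k^-1 * x)%g) -ghE !mulgA mulVg mul1g.
have := orbit_primitiveM g h xgh; have := orbit_primitiveM h g xhg.
rewrite !mulgA !mulVg !mul1g => e1 e2.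
have -> : orbit_primitive (h * g)%g (h * g)%g
  = orbit_primitive h (h * g)%g + orbit_primitive g (g * h)%g - w h g.
  by rewrite -e1 addrK.
by rewrite /cocycle_alt addrA e2 [X in X - _ = _]addrC.
Qed.

Variable conjugator : G -> G.
Hypothesis conjugatorP : forall y, conj_class x y ->
  ((conjugator y)^-1 * x * conjugator y)%g = y.

(** Both sides change in the same way along the class, by orbit_primitive_swap
    applied to k y and k^-1 with product x, and at x the transporter is the
    centralizer, so that the average is psi x. *)
Lemma orbit_primitive_diag (y : G) : conj_class x y ->
  orbit_primitive y y = xi w x conjugator y.
Proof.
move=> xy; rewrite /xi asboolT//.
set k := conjugator y; have ky : (k^-1 * x * k)%g = y by exact: conjugatorP.
have kyV : (k * y * k^-1)%g = x by rewrite -ky !mulgA mulgV mul1g mulgK.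
have xx : conj_class x (k * y * k^-1)%g.
  by rewrite kyV; exists 1%g; rewrite invg1 mul1g mulg1.
have := orbit_primitive_swap xx.
rewrite kyV !mulgA mulVg mul1g => <-; congr (_ + _).
by rewrite /orbit_primitive transporter_self.
Qed.

End OrbitPrimitive.

(** * Estimates of second order in s - t *)

Section Quadratic.
Variable R : realType.
Local Notation I := (unit_interval R).
Implicit Types (c d : I -> R[i]) (h : I -> I -> R[i]).

(** Mean value theorem, with the derivative bounded by its maximum on [0, 1]. *)
Lemma smooth_lipschitz_real (u : R -> R) : smooth u ->
  exists M : R, forall s t : I, `|u (val s) - u (val t)| <= M * `|val s - val t|.
Proof.
move=> su; have du y : derivable u y 1 := su 0%N y.
have ddu y : derivable (u^`()%classic) y 1 by have := su 1%N y.
have cu : continuous u by move=> y; exact/differentiable_continuous/derivable1_diffP.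
have cdu : continuous (fun y => `|u^`()%classic y|).
  move=> y; apply: continuous_comp; last exact: norm_continuous.
  exact/differentiable_continuous/derivable1_diffP.
have [m _ hm] := @EVT_max R (fun y => `|u^`()%classic y|) 0 1 ler01
  (continuous_subspaceT cdu).
exists `|u^`()%classic m|.
have hle a b : 0 <= a -> a <= b -> b <= 1 ->
    `|u b - u a| <= `|u^`()%classic m| * `|b - a|.
  move=> a0 ab b1.
  have dab y : y \in `]a, b[ -> is_derive y 1 u (u^`()%classic y).
    by move=> _; rewrite derive1E; apply: DeriveDef.
  have [y yab ->] := MVT_segment ab dab (continuous_subspaceT cu).
  rewrite normrM ler_wpM2r//; apply: hm.
  by move: yab; rewrite !in_itv/= => /andP[ay yb]; rewrite (le_trans a0)//= (le_trans yb).
move=> [s /andP[s0 s1]] [t /andP[t0 t1]] /=.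
have [ts|/ltW st] := leP t s; first exact: hle.
by rewrite (distrC (u s)) (distrC s); exact: hle.
Qed.

Definition lipschitz_I c := exists M : R, forall s t : I,
  `|c s - c t| <= (M * `|val s - val t|)%:C.

Lemma smooth_lipschitz c : smooth_on_I c -> lipschitz_I c.
Proof.
move=> [u [v [/smooth_lipschitz_real[M hM] /smooth_lipschitz_real[N hN] cE]]].
exists (M + N) => s t.
have -> : c s - c t = (u (val s) - u (val t))%:C + 'i * (v (val s) - v (val t))%:C.
  by rewrite !cE; apply/eqP; rewrite eq_complex /=; apply/andP; split; apply/eqP; ring.
apply: (le_trans (ler_normD _ _)); rewrite normrM normCi mul1r.
rewrite !normc_def /= expr0n /= !addr0 !sqrtr_sqr mulrDl rmorphD /=.
by apply: lerD; rewrite lecR; [exact: hM | exact: hN].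
Qed.

Lemma smooth_bounded c : smooth_on_I c -> exists M : R, forall t, `|c t| <= M%:C.
Proof.
move=> /smooth_lipschitz[M hM].
have h0 : 0 <= (0 : R) <= 1 by rewrite lexx ler01.
pose o : I := exist _ 0 h0.
exists (Normc.normc (c o) + `|M|) => t.
rewrite -[c t](subrK (c o)) addrC (le_trans (ler_normD _ _))// rmorphD/= lerD//.
rewrite (le_trans (hM _ _))// lecR /= subr0; case: t => t /= /andP[t0 t1].
by rewrite (ger0_norm t0) (le_trans (ler_norm _))// normrM (ger0_norm t0) ler_piMr.
Qed.

Lemma smooth_on_I_prod (J : Type) (r : seq J) (F : J -> I -> R[i]) :
  (forall j, smooth_on_I (F j)) -> smooth_on_I (fun t => \prod_(j <- r) F j t).
Proof.
move=> sF; elim: r => [|j r IH].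
  under eq_fun do rewrite big_nil.
  exact: smooth_on_I_cst.
under eq_fun do rewrite big_cons.
exact: smooth_on_IM.
Qed.

(** Vanishing to second order on the diagonal, uniformly on the interval: the
    error term of all identities between functionals at two times. *)
Definition quadratic h := exists M : R, forall s t : I,
  `|h s t| <= (M * (val s - val t) ^+ 2)%:C.

Lemma quadratic0 : quadratic (fun _ _ => 0).
Proof. by exists 0 => s t; rewrite normr0 mul0r. Qed.

Lemma quadraticD h h' : quadratic h -> quadratic h' ->
  quadratic (fun s t => h s t + h' s t).
Proof.
move=> [M hM] [N hN]; exists (M + N) => s t.
by rewrite (le_trans (ler_normD _ _))// mulrDl rmorphD lerD.
Qed.

Lemma quadraticMl c h : smooth_on_I c -> quadratic h ->
  quadratic (fun s t => c t * h s t).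
Proof.
move=> /smooth_bounded[M hM] [N hN]; exists (M * N) => s t.
by rewrite normrM -mulrA rmorphM ler_pM.
Qed.

Lemma quadraticZ k h : quadratic h -> quadratic (fun s t => k * h s t).
Proof. exact: (quadraticMl (smooth_on_I_cst k)). Qed.

Lemma quadratic_sum (J : Type) (r : seq J) (H : J -> I -> I -> R[i]) :
  (forall j, quadratic (H j)) -> quadratic (fun s t => \sum_(j <- r) H j s t).
Proof.
move=> qH; elim: r => [|j r IH].
  under eq_fun do under eq_fun do rewrite big_nil.
  exact: quadratic0.
under eq_fun do under eq_fun do rewrite big_cons.
exact: quadraticD.
Qed.

Lemma quadratic_diffM c d : smooth_on_I c -> smooth_on_I d ->
  quadratic (fun s t => (c s - c t) * (d s - d t)).
Proof.
move=> /smooth_lipschitz[M hM] /smooth_lipschitz[N hN]; exists (M * N) => s t.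
rewrite normrM -(real_normK (num_real (val s - val t))) expr2 mulrACA rmorphM.
by rewrite ler_pM.
Qed.

(** The Leibniz rule for finite increments. Splitting off the first factor F_0,
    the defect is F_0(t) times the defect of the other factors minus the product
    of the increments of F_0 and of the product of the others. *)
Lemma quadratic_leibniz n (F : 'I_n -> I -> R[i]) : (forall i, smooth_on_I (F i)) ->
  quadratic (fun s t => \sum_(i < n) (F i s - F i t) * \prod_(j < n | j != i) F j t
    - (\prod_(i < n) F i s - \prod_(i < n) F i t)).
Proof.
elim: n F => [|n IH] F sF.
  under eq_fun do under eq_fun do rewrite !big_ord0 subrr subr0.
  exact: quadratic0.
pose F' i := F (lift ord0 i).
have q1 := quadraticMl (sF ord0) (IH F' (fun i => sF _)).
have sP := smooth_on_I_prod (index_enum 'I_n) (fun i => sF (lift ord0 i)).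
have q2 := quadraticZ (-1) (quadratic_diffM (sF ord0) sP).
have := quadraticD q1 q2; congr quadratic; apply/funext => s; apply/funext => t.
rewrite !big_ord_recl.
have -> : \prod_(j < n.+1 | j != ord0) F j t = \prod_(j < n) F' j t.
  rewrite big_mkcond big_ord_recl/= mul1r; exact: eq_bigr.
have -> : \sum_(i < n) (F (lift ord0 i) s - F (lift ord0 i) t) *
     \prod_(j < n.+1 | j != lift ord0 i) F j t
   = F ord0 t * \sum_(i < n) (F' i s - F' i t) * \prod_(j < n | j != i) F' j t.
  rewrite mulr_sumr; apply: eq_bigr => i _.
  rewrite big_mkcond big_ord_recl/=.
  rewrite (eq_bigr (fun j => if j != i then F' j t else 1)); last first.
    by move=> j _; rewrite (inj_eq lift_inj).
  by rewrite -big_mkcond /F'; ring.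
rewrite /F'; ring.
Qed.

(** Cut the segment from s to t into N equal parts: the increment of c is at most
    N times M / N^2. *)
Lemma quadratic_constant c :
  quadratic (fun s t => c s - c t) -> forall s t, c s = c t.
Proof.
move=> [M hM] s t; apply/eqP; apply: contraT => cst.
have e0 : 0 < Normc.normc (c s - c t).
  have : 0 < `|c s - c t| by rewrite normr_gt0 subr_eq0.
  by rewrite -ltcR.
(* With M the quadratic constant, N is chosen so that M / N is smaller than the
   distance of c s and c t. *)
pose N := (Num.trunc (`|M| / Normc.normc (c s - c t))).+1.
have N0 : 0 < N%:R :> R by rewrite ltr0n.
have MN : `|M| < Normc.normc (c s - c t) * N%:R.
  by rewrite mulrC -ltr_pdivrMr// truncnS_gt.
pose q (k : nat) : R := val s + (val t - val s) * (k%:R / N%:R).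
have qI k : (k <= N)%N -> 0 <= q k <= 1.
  move=> kN; have k0 : 0 <= k%:R / N%:R :> R by rewrite divr_ge0.
  have k1 : k%:R / N%:R <= 1 :> R by rewrite ler_pdivrMr// mul1r ler_nat.
  have := svalP s; have := svalP t; rewrite /q /= => /andP[t0 t1] /andP[s0 s1].
  move: (k%:R / N%:R) k0 k1 => z z0 z1; apply/andP; split; nra.
(* The default s of insubd is never reached for k <= N. *)
pose p k : I := insubd s (q k).
have pE k : (k <= N)%N -> val (p k) = q k.
  by move=> /qI qk; rewrite /p insubdK.
have step k : (k < N)%N -> `|c (p k) - c (p k.+1)| <= (`|M| * (N%:R^-1) ^+ 2)%:C.
  move=> kN; apply: (le_trans (hM _ _)); rewrite lecR.
  rewrite !pE//; last exact: ltnW.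
  have -> : q k - q k.+1 = (val s - val t) * N%:R^-1.
    by rewrite /q -natr1; ring.
  rewrite exprMn mulrA ler_wpM2r ?exprn_ge0 ?invr_ge0//.
  have st1 : (val s - val t) ^+ 2 <= 1.
    have /andP[s0 s1] : 0 <= val s <= 1 := svalP s.
    have /andP[t0 t1] : 0 <= val t <= 1 := svalP t.
    have -> : (val s - val t) ^+ 2 = 1 - (1 - (val s - val t)) * (1 + (val s - val t)) by ring.
    by rewrite gerBl mulr_ge0//; lra.
  by rewrite (le_trans (ler_wpM2r (sqr_ge0 _) (ler_norm M)))// ler_piMr.
have tele k : (k <= N)%N -> `|c (p 0%N) - c (p k)| <= (k%:R * (`|M| * (N%:R^-1) ^+ 2))%:C.
  elim: k => [|k IH] kN; first by rewrite subrr normr0 mul0r.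
  have -> : c (p 0%N) - c (p k.+1) = (c (p 0%N) - c (p k)) + (c (p k) - c (p k.+1)).
    by rewrite addrA subrK.
  apply: (le_trans (ler_normD _ _)); rewrite -natr1 mulrDl mul1r rmorphD lerD//.
    by rewrite IH// ltnW.
  exact: step.
have := tele _ (leqnn N).
have -> : p 0%N = s by apply: val_inj; rewrite pE// /q mul0r mulr0 addr0.
have -> : p N = t.
  by apply: val_inj; rewrite pE// /q divff ?gt_eqF// mulr1 addrC subrK.
rewrite -[X in X <= _ -> _]/((Normc.normc (c s - c t))%:C) lecR.
rewrite expr2 mulrCA (mulrA N%:R) divff ?gt_eqF// mul1r ler_pdivlMr//.
by rewrite leNgt MN.
Qed.

End Quadratic.

(** * Multilinear functionals on tuples *)

(** Decides an equality between two entries of tuples given by case distinctions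
    on their index, up to associativity of the product. *)
Ltac tuple_cases := try lia;
  repeat match goal with |- context [nat_of_ord (@Ordinal ?n ?m ?H)] =>
    change (nat_of_ord (@Ordinal n m H)) with m
  | |- context [nat_of_ord (@ord0 ?n)] =>
    change (nat_of_ord (@ord0 n)) with 0%N end;
  repeat match goal with |- context [if ?b then _ else _] =>
    let H := fresh "H" in destruct b eqn:H; try (exfalso; lia) end;
  rewrite ?mulrA; try reflexivity; repeat f_equal; lia.

Section Multilinear.
Variables (K : fieldType) (V : algType K).

Lemma tuple_nthP n (x y : n.-tuple V) :
  (forall j, (j < n)%N -> x`_j = y`_j) -> x = y.
Proof.
move=> xy; apply: val_inj; apply: (@eq_from_nth _ 0); rewrite !size_tuple//.
Qed.

Lemma nth_mktuple_lt (T : Type) (x0 : T) n (F : 'I_n -> T) j (jn : (j < n)%N) :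
  nth x0 [tuple F i | i < n] j = F (Ordinal jn).
Proof. by rewrite -[j]/(val (Ordinal jn)) nth_mktuple. Qed.

Lemma nth_subst n (x : n.+1.-tuple V) (i : 'I_n.+1) (a : V) j :
  (subst_tuple x i a)`_j = if j == i :> nat then a else x`_j.
Proof.
have [jn|nj] := ltnP j n.+1.
  by rewrite nth_mktuple_lt -val_eqE/= (tnth_nth 0).
rewrite !nth_default ?size_tuple//; case: eqP => // ji.
by move: nj; rewrite ji leqNgt ltn_ord.
Qed.

Lemma nth_face n (x : n.+2.-tuple V) i j : (j < n.+1)%N ->
  (face x i)`_j = if (i <= n)%N then
      if (j < i)%N then x`_j else if j == i then x`_j * x`_j.+1 else x`_j.+1
    else if j == 0%N then x`_n.+1 * x`_0 else x`_j.
Proof. by move=> jn; rewrite /face; case: ifP => _; rewrite nth_mktuple_lt. Qed.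

Lemma nth_face0S n (x : n.+2.-tuple V) j : (face x 0)`_j.+1 = x`_j.+2.
Proof.
have [jn|nj] := ltnP j.+1 n.+1; first by rewrite nth_face.
by rewrite !nth_default ?size_tuple.
Qed.

Lemma subst_tuple_id n (x : n.+1.-tuple V) i : subst_tuple x i (tnth x i) = x.
Proof. by apply: eq_from_tnth => j; rewrite tnth_mktuple; case: eqP => [->|]. Qed.

(** A face map is multilinear: the entry put in slot j lands in a single slot of
    the face, as it is or multiplied by the fixed entry next to it. *)
Lemma face_subst n (x : n.+2.-tuple V) (j : 'I_n.+2) i :
  exists (j' : 'I_n.+1) (L : V -> V), linear L /\
    forall a, face (subst_tuple x j a) i = subst_tuple (face x i) j' (L a).
Proof.
have [li|ni] := leqP i n.
  have [ji|ij] := ltnP j i.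
    have jn : (j < n.+1)%N by lia.
    exists (Ordinal jn), id; split=> // a; apply: tuple_nthP => l ln.
    rewrite nth_subst !nth_face// !nth_subst /= li; tuple_cases.
  have [ji|ji] := eqVneq (j : nat) i.
    have jn : (i < n.+1)%N by lia.
    exists (Ordinal jn), (fun a => a * x`_i.+1); split=> [k u v|a].
      by rewrite mulrDl scalerAl.
    apply: tuple_nthP => l ln.
    rewrite nth_subst !nth_face// !nth_subst /= li; tuple_cases.
  have [ji1|ji1] := eqVneq (j : nat) i.+1.
    have jn : (i < n.+1)%N by lia.
    exists (Ordinal jn), (fun a => x`_i * a); split=> [k u v|a].
      by rewrite mulrDr scalerAr.
    apply: tuple_nthP => l ln.
    rewrite nth_subst !nth_face// !nth_subst /= li; tuple_cases.
  have jn : (j.-1 < n.+1)%N by have := ltn_ord j; lia.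
  exists (Ordinal jn), id; split=> // a; apply: tuple_nthP => l ln.
  rewrite nth_subst !nth_face// !nth_subst /= li; tuple_cases.
have ni' : (i <= n)%N = false by lia.
have [j0|j0] := eqVneq (j : nat) 0%N.
  exists ord0, (fun a => x`_n.+1 * a); split=> [k u v|a].
    by rewrite mulrDr scalerAr.
  apply: tuple_nthP => l ln.
  rewrite nth_subst !nth_face// !nth_subst /= ni'; tuple_cases.
have [jl|jl] := eqVneq (j : nat) n.+1.
  exists ord0, (fun a => a * x`_0); split=> [k u v|a].
    by rewrite mulrDl scalerAl.
  apply: tuple_nthP => l ln.
  rewrite nth_subst !nth_face// !nth_subst /= ni'; tuple_cases.
have jn : (j < n.+1)%N by have := ltn_ord j; lia.
exists (Ordinal jn), id; split=> // a; apply: tuple_nthP => l ln.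
rewrite nth_subst !nth_face// !nth_subst /= ni'; tuple_cases.
Qed.

(** The simplicial identity d_j d_0 = d_0 d_(j+1); for j = n+1 these are the
    cyclic faces. *)
Lemma face_face0 n (x : n.+3.-tuple V) j : (j <= n.+1)%N ->
  face (face x 0) j = face (face x j.+1) 0.
Proof.
move=> jn; apply: tuple_nthP => l ln.
have [lj|jl] := leqP j n.
  rewrite !nth_face// ?ltnS ?lj ?leq0n//=; tuple_cases.
have -> : j = n.+1 by lia.
rewrite !nth_face// ?ltnS ?ltnn ?leq0n//=; tuple_cases.
Qed.

Lemma nth_rot_tuple (T : Type) (x0 : T) n (x : n.+1.-tuple T) i j :
  (i <= n)%N -> (j <= n)%N ->
  nth x0 (rot i x) j
  = nth x0 x (if (j + i <= n)%N then j + i else j + i - n.+1)%N.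
Proof.
move=> ni nj; rewrite nth_cat size_drop size_tuple; case: ifP => c1; last first.
  rewrite nth_take; last by lia.
  by congr nth; case: ifP => c2; lia.
by rewrite nth_drop addnC; case: ifP => // c2; lia.
Qed.

Lemma nth_cons_rot n (x : n.+1.-tuple V) i j : (i <= n)%N -> (j < n.+2)%N ->
  [tuple of 1 :: rot i x]`_j
  = if j is l.+1 then x`_(if l + i <= n then l + i else l + i - n.+1)%N
    else 1.
Proof. by move=> ni; case: j => // l ln; exact: nth_rot_tuple. Qed.

Lemma cons_rot_subst n (x : n.+1.-tuple V) (j : 'I_n.+1) i : (i <= n)%N ->
  exists j' : 'I_n.+2, forall a,
    [tuple of 1 :: rot i (subst_tuple x j a)]
    = subst_tuple [tuple of 1 :: rot i x] j' a.
Proof.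
move=> ni; have jn := ltn_ord j.
have [ij|ji] := leqP i j.
  have j'n : ((j - i).+1 < n.+2)%N by lia.
  exists (Ordinal j'n) => a; apply: tuple_nthP => l ln.
  rewrite nth_subst !nth_cons_rot//; case: l ln => // l ln.
  rewrite !nth_subst /=; tuple_cases.
have j'n : ((j + n.+1 - i).+1 < n.+2)%N by lia.
exists (Ordinal j'n) => a; apply: tuple_nthP => l ln.
rewrite nth_subst !nth_cons_rot//; case: l ln => // l ln.
rewrite !nth_subst /=; tuple_cases.
Qed.

Definition multilinear n (F : n.+1.-tuple V -> K) := forall k x i a b,
  F (subst_tuple x i (k *: a + b))
  = k * F (subst_tuple x i a) + F (subst_tuple x i b).

Lemma multilinear_eq0 n (F : n.+1.-tuple V -> K) x i :
  multilinear F -> tnth x i = 0 -> F x = 0.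
Proof.
move=> FP xi; rewrite -[x](subst_tuple_id x i) xi.
by have := FP (-1) x i 0 0; rewrite scaler0 addr0 mulN1r addNr.
Qed.

Lemma multilinear_face n (F : n.+1.-tuple V -> K) i :
  multilinear F -> multilinear (fun x => F (face x i)).
Proof.
move=> FP k x j a b; have [j' [L [LP xL]]] := face_subst x j i.
by rewrite !xL LP FP.
Qed.

Lemma multilinear_cons_rot n (F : n.+2.-tuple V -> K) i : (i <= n)%N ->
  multilinear F -> multilinear (fun x : n.+1.-tuple V => F [tuple of 1 :: rot i x]).
Proof.
move=> ni FP k x j a b; have [j' xj] := cons_rot_subst x j ni.
by rewrite !xj FP.
Qed.

Lemma multilinear_sum n (J : eqType) (r : seq J) (c : J -> K)
    (F : J -> n.+1.-tuple V -> K) :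
  (forall j, j \in r -> multilinear (F j)) ->
  multilinear (fun x => \sum_(j <- r) c j * F j x).
Proof.
move=> FP k x i a b; rewrite mulr_sumr -big_split /=.
by apply: eq_big_seq => j /FP ->; ring.
Qed.

(** Pull the scalars out of the slots one after the other. *)
Lemma multilinear_scale n (F : n.+1.-tuple V -> K) (l : 'I_n.+1 -> K) v :
  multilinear F ->
  F [tuple l i *: tnth v i | i < n.+1] = (\prod_(i < n.+1) l i) * F v.
Proof.
move=> FP; pose x m := [tuple (if (i < m)%N then l i else 1) *: tnth v i | i < n.+1].
have xP m : (m <= n.+1)%N -> F (x m) = (\prod_(i < n.+1 | (i < m)%N) l i) * F v.
  elim: m => [|m IH] mn.
    rewrite big_pred0// mul1r; congr F; apply: eq_from_tnth => i.
    by rewrite tnth_mktuple scale1r.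
  have xm : x m = subst_tuple (x m) (Ordinal mn) (tnth v (Ordinal mn)).
    apply: eq_from_tnth => i; rewrite !tnth_mktuple; case: eqP => // ->.
    by rewrite ltnn scale1r.
  have -> : x m.+1 = subst_tuple (x m) (Ordinal mn)
      (l (Ordinal mn) *: tnth v (Ordinal mn) + 0).
    apply: eq_from_tnth => i; rewrite !tnth_mktuple addr0.
    have [->|im] := eqVneq i (Ordinal mn); first by rewrite ltnSn.
    suff -> : (i < m.+1)%N = (i < m)%N by [].
    by move: im; rewrite -val_eqE /= => im; lia.
  rewrite FP (@multilinear_eq0 _ _ (subst_tuple _ _ 0) (Ordinal mn))//; last first.
    by rewrite tnth_mktuple eqxx.
  rewrite addr0 -xm IH ?(ltnW mn)// mulrA; congr (_ * _).
  rewrite [RHS](bigD1 (Ordinal mn))//=; congr (_ * _); apply: eq_bigl => i.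
  by rewrite -val_eqE /=; lia.
have := xP n.+1 (leqnn _); rewrite (eq_bigl xpredT); last by move=> i; rewrite ltn_ord.
move=> <-; congr F; apply: eq_from_tnth => i.
by rewrite !tnth_mktuple ltn_ord.
Qed.

(** The slots are released from S one at a time, from the first to the last. *)
Lemma slot_ind n (S : V -> Prop) (P : n.+1.-tuple V -> Prop) :
  (forall x, (forall i, S (tnth x i)) -> P x) ->
  (forall x i, (forall a, S a -> P (subst_tuple x i a)) ->
     forall a, P (subst_tuple x i a)) ->
  forall x, P x.
Proof.
move=> PS Pi x.
suff H m : forall x, (forall i : 'I_n.+1, (m <= i)%N -> S (tnth x i)) -> P x.
  by apply: (H n.+1) => i; rewrite leqNgt ltn_ord.
(* Slots with index at least m are already known to be in S. *)
elim: m => [|m IH] {}x xm; first by apply: PS => i; exact: xm.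
have [mn|nm] := ltnP m n.+1; last by apply: IH => i; have := ltn_ord i; lia.
rewrite -(subst_tuple_id x (Ordinal mn)); apply: Pi => a Sa; apply: IH => i mi.
rewrite tnth_mktuple; case: eqP => // im; apply: xm.
by rewrite ltn_neqAle mi andbT; apply/eqP => mi'; apply/im/val_inj.
Qed.

Lemma pairing_linext n m (F : m.+1.-tuple V -> K)
    (f : n.+1.-tuple V -> chain V m) (c : chain V n) :
  pairing F (linext f c) = \sum_(p <- c) p.1 * pairing F (f p.2).
Proof.
rewrite /pairing /linext big_flatten big_map; apply: eq_bigr => p _.
by rewrite big_map mulr_sumr; apply: eq_bigr => q _; rewrite mulrA.
Qed.

Lemma multilinear_pairing_b n (F : n.+1.-tuple V -> K) :
  multilinear F -> multilinear (fun x => pairing F (b_tensor x)).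
Proof.
move=> FP k x i a b; rewrite /pairing !big_map.
exact: (@multilinear_sum _ _ _ (fun i => (-1) ^+ i) (fun i x => F (face x i))
  (fun j _ => multilinear_face j FP)).
Qed.

Lemma multilinear_pairing_B n (F : n.+2.-tuple V -> K) :
  multilinear F -> multilinear (fun x => pairing F (B_tensor x)).
Proof.
move=> FP k x i a b; rewrite /pairing !big_map.
apply: (@multilinear_sum _ _ _ (fun i => (-1) ^+ (n * i))
  (fun i (x : n.+1.-tuple V) => F [tuple of 1 :: rot i x])) => j.
by rewrite mem_iota => jn; apply: multilinear_cons_rot => //; lia.
Qed.

End Multilinear.

(** * Inserting an increment into a cyclic cocycle *)

Section CyclicCocycle.
Variables (K : fieldType) (V : algType K).

Definition splice1 n (a b : n.-tuple V) : n.-tuple V :=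
  [tuple if j == 1%N :> nat then tnth b j else tnth a j | j < n].

Lemma nth_splice1 n (a b : n.-tuple V) j :
  (splice1 a b)`_j = if j == 1%N then b`_j else a`_j.
Proof.
have [jn|nj] := ltnP j n; first by rewrite nth_mktuple_lt !(tnth_nth 0).
by rewrite !nth_default ?size_tuple// if_same.
Qed.

(** The value of phi (a_0 D(a_1), a_2, ...) where the derivation D is replaced
    by the increment b_1 - a_1. *)
Definition insertion_defect n (phi : n.+1.-tuple V -> K) (a b : n.+2.-tuple V) : K :=
  phi (face (splice1 a b) 0) - phi (face a 0).

(** With a derivation D in place of the increment the sum would vanish, since
    phi is closed. The increment d of an algebra map obeys instead
    d(a_1 a_2) = d(a_1) a_2 + a_1 d(a_2) + d(a_1) d(a_2), and the right-hand side
    is the contribution of the last term. The faces from the second one on add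
    up to d(a_1) a_2 inserted between a_0 and a_3, because phi vanishes on the
    boundary of the tuple (a_0 d(a_1), a_2, ...). *)
Lemma insertion_defect_b n (phi : n.+1.-tuple V -> K) (a b : n.+3.-tuple V) :
  multilinear phi -> (forall x, pairing phi (b_tensor x) = 0) ->
  \sum_(i <- iota 0 n.+3)
     (-1) ^+ i * insertion_defect phi (face a i) (face b i)
  = - phi (subst_tuple (face (face a 0) 0) ord0
             (a`_0 * (b`_1 - a`_1) * (b`_2 - a`_2))).
Proof.
move=> phiP phib; set X := splice1 a b.
(* All terms have the form phi (u, a_3, ..., a_(n+2)). *)
set T := fun u => phi (subst_tuple (face (face a 0) 0) ord0 u).
have TB u v : T (u - v) = T u - T v.
  by have := phiP (-1) (face (face a 0) 0) ord0 v u; rewrite /T scaleN1r mulN1r addrC => ->;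
    rewrite addrC.
have T0 : phi (face (face a 0) 0) = T (a`_0 * a`_1 * a`_2).
  rewrite /T; congr phi; apply: tuple_nthP => l ln.
  rewrite nth_subst !nth_face//; tuple_cases.
have closed (y : n.+2.-tuple V) :
    phi (face y 0) = - \sum_(i <- iota 1 n.+1) (-1) ^+ i * phi (face y i).
  apply/eqP; rewrite -addr_eq0; have := phib y; rewrite /pairing big_map big_cons /=.
  by rewrite expr0 mul1r => ->.
(* Faces from the second on are, up to sign, the faces from the first on of
   (y_0 y_1, y_2, ...), on which phi is closed. *)
have tail (y : n.+3.-tuple V) :
    \sum_(i <- iota 2 n.+1) (-1) ^+ i * phi (face (face y i) 0) = phi (face (face y 0) 0).
  rewrite closed -sumrN -[2%N]/(1 + 1)%N iotaDl big_map big_seq [RHS]big_seq.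
  apply: eq_bigr => i; rewrite mem_iota => /andP[_ ni].
  by rewrite face_face0; [rewrite add1n exprS; ring|lia].
rewrite -[iota 0 n.+3]/[:: 0, 1 & iota 2 n.+1]%N 2!big_cons expr0 mul1r expr1 mulN1r.
have -> : \sum_(i <- iota 2 n.+1) (-1) ^+ i * insertion_defect phi (face a i) (face b i)
    = T (a`_0 * b`_1 * a`_2) - T (a`_0 * a`_1 * a`_2).
  have -> : T (a`_0 * b`_1 * a`_2) = phi (face (face X 0) 0).
    rewrite /T; congr phi; apply: tuple_nthP => l ln.
    rewrite nth_subst !nth_face// ?nth_splice1; tuple_cases.
  rewrite -T0 -!tail -sumrB big_seq [RHS]big_seq.
  apply: eq_bigr => i; rewrite mem_iota => /andP[i2 ni].
  rewrite -mulrBr /insertion_defect; congr (_ * (phi (face _ _) - _)).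
  apply: tuple_nthP => l ln; rewrite nth_splice1 !nth_face// !nth_splice1.
  tuple_cases.
rewrite /insertion_defect.
have -> : phi (face (splice1 (face a 0) (face b 0)) 0) = T (a`_0 * a`_1 * b`_2).
  rewrite /T; congr phi; apply: tuple_nthP => l ln.
  rewrite nth_subst !nth_face// ?nth_splice1 ?nth_face//; tuple_cases.
have -> : phi (face (splice1 (face a 1) (face b 1)) 0) = T (a`_0 * (b`_1 * b`_2)).
  rewrite /T; congr phi; apply: tuple_nthP => l ln.
  rewrite nth_subst !nth_face// ?nth_splice1 ?nth_face//; tuple_cases.
rewrite -(face_face0 a (leq0n _)) T0 -/(T _).
have -> : a`_0 * (b`_1 - a`_1) * (b`_2 - a`_2)
  = (a`_0 * (b`_1 * b`_2) - a`_0 * a`_1 * b`_2)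
    - (a`_0 * b`_1 * a`_2 - a`_0 * a`_1 * a`_2).
  by rewrite mulrBr (mulrBr a`_0) !mulrBl mulrA.
rewrite !TB; ring.
Qed.

Lemma cyclic_rotE n (phi : n.+1.-tuple V -> K) (x : n.+1.-tuple V) i :
  is_cyclic_cocycle phi -> (i <= n)%N ->
  phi [tuple of rot i x] = (-1) ^+ (n * i) * phi x.
Proof.
move=> phic; have rot1 (y : n.+1.-tuple V) : phi [tuple of rot 1 y] = (-1) ^+ n * phi y.
  have := cyclic_rot phic [tuple of rot 1 y].
  have -> : [tuple of rotr 1 [tuple of rot 1 y]] = y by apply: val_inj; exact: rotK.
  by move=> ->; rewrite mulrA -expr2 sqrr_sign mul1r.
elim: i => [|i IH] ni.
  rewrite muln0 mul1r; congr phi; apply: val_inj; exact: rot0.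
have -> : [tuple of rot i.+1 x] = [tuple of rot 1 [tuple of rot i x]].
  by apply: val_inj; rewrite /= rotS// size_tuple ltnS ltnW.
by rewrite rot1 IH ?(ltnW ni)// mulnS exprD mulrA.
Qed.

(** The unit in slot 0 brings the increment of a_i to slot 0 of phi, and
    cyclicity moves it back to slot i. *)
Lemma insertion_defect_B n (phi : n.+1.-tuple V -> K) (a b : n.+1.-tuple V) i
    (ni : (i < n.+1)%N) : is_cyclic_cocycle phi ->
  insertion_defect phi [tuple of 1 :: rot i a] [tuple of 1 :: rot i b]
  = (-1) ^+ (n * i) * (phi (subst_tuple a (Ordinal ni) (tnth b (Ordinal ni))) - phi a).
Proof.
move=> phic; rewrite /insertion_defect mulrBr -!cyclic_rotE//.
have face1 (y : n.+1.-tuple V) : face [tuple of 1 :: y] 0 = y.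
  by apply: tuple_nthP => l ln; rewrite nth_face//=; case: eqP => [->|] /=; rewrite ?mul1r.
set y := [tuple of rot i (subst_tuple a _ _)].
have -> : splice1 [tuple of 1 :: rot i a] [tuple of 1 :: rot i b] = [tuple of 1 :: y].
  apply: tuple_nthP => l ln.
  rewrite nth_splice1 !nth_cons_rot//.
  case: l ln => // l ln.
  rewrite !nth_subst !(tnth_nth 0) /=; tuple_cases.
by rewrite (face1 y) (face1 [tuple of rot i a]).
Qed.

End CyclicCocycle.

(** * Untwisting homogeneous tuples *)

Section GroupTuples.
Variable G : groupType.
Implicit Types (g : seq G).

Definition prefix_prod g j : G := (\prod_(0 <= k < j) nth 1 g k)%g.

(** The product of the degrees read cyclically from slot j on, written as a
    conjugate of the total product. *)
Definition holonomy g j : G :=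
  ((prefix_prod g j)^-1 * prefix_prod g (size g) * prefix_prod g j)%g.

Lemma prefix_prod0 g : prefix_prod g 0 = 1%g.
Proof. by rewrite /prefix_prod big_nil. Qed.

Lemma prefix_prodS g j : prefix_prod g j.+1 = (prefix_prod g j * nth 1 g j)%g.
Proof. by rewrite /prefix_prod big_nat_recr. Qed.

Lemma prefix_prod_take g j : (j <= size g)%N ->
  (\prod_(h <- take j g) h)%g = prefix_prod g j.
Proof.
move=> js; rewrite (big_nth 1%g) size_takel// /prefix_prod.
by apply: eq_big_nat => k /andP[_ kj]; rewrite nth_take.
Qed.

Lemma prefix_prod_size g : prefix_prod g (size g) = (\prod_(h <- g) h)%g.
Proof. by rewrite -prefix_prod_take// take_size. Qed.

Lemma holonomyS g j :
  holonomy g j.+1 = ((nth 1 g j)^-1 * holonomy g j * nth 1 g j)%g.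
Proof. by rewrite /holonomy prefix_prodS invgM !mulgA. Qed.

(** The degrees of a face of a homogeneous tuple of degrees g. *)
Definition gface n (g : n.+2.-tuple G) (i : nat) : n.+1.-tuple G :=
  if (i <= n)%N then
    [tuple if (j < i)%N then nth 1%g g j
           else if (j == i :> nat)%N then (nth 1 g j * nth 1 g j.+1)%g
           else nth 1%g g j.+1 | j < n.+1]
  else [tuple if (j == 0 :> nat)%N then (nth 1 g n.+1 * nth 1 g 0)%g
              else nth 1%g g j | j < n.+1].

Lemma nth_gface n (g : n.+2.-tuple G) i j : (j < n.+1)%N ->
  nth 1%g (gface g i) j = if (i <= n)%N then
      if (j < i)%N then nth 1%g g j
      else if j == i then (nth 1 g j * nth 1 g j.+1)%g else nth 1%g g j.+1
    else if j == 0%N then (nth 1 g n.+1 * nth 1 g 0)%g else nth 1%g g j.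
Proof. by move=> jn; rewrite /gface; case: ifP => _; rewrite nth_mktuple_lt. Qed.

Lemma prefix_prod_gface n (g : n.+2.-tuple G) i j : (i <= n)%N -> (j <= n.+1)%N ->
  prefix_prod (gface g i) j
  = if (j <= i)%N then prefix_prod g j else prefix_prod g j.+1.
Proof.
move=> ni; elim: j => [|j IH] jn; first by rewrite leq0n !prefix_prod0.
rewrite prefix_prodS IH ?(ltnW jn)// nth_gface// ni.
have [ji|ij|->] := ltngtP j i; first by rewrite prefix_prodS.
  by rewrite (prefix_prodS g j.+1).
by rewrite !prefix_prodS mulgA.
Qed.

Lemma prefix_prod_gface_last n (g : n.+2.-tuple G) i j : (n < i)%N ->
  (0 < j <= n.+1)%N ->
  prefix_prod (gface g i) j = (nth 1 g n.+1 * prefix_prod g j)%g.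
Proof.
move=> ni; have ni' : (i <= n)%N = false by lia.
case: j => // j; elim: j => [|j IH] jn.
  by rewrite !prefix_prodS !prefix_prod0 nth_gface// ni' !mul1g.
rewrite prefix_prodS IH; last by lia.
by rewrite nth_gface// ni' (prefix_prodS g j.+1) mulgA.
Qed.

Lemma holonomy_gface n (g : n.+2.-tuple G) i j : (i <= n)%N -> (j <= n)%N ->
  holonomy (gface g i) j = if (j <= i)%N then holonomy g j else holonomy g j.+1.
Proof.
move=> ni nj; rewrite /holonomy !size_tuple !prefix_prod_gface//; last by lia.
have -> : (n < i)%N = false by lia.
by case: ifP.
Qed.

Lemma holonomy_gface_last n (g : n.+2.-tuple G) i j : (n < i)%N -> (j <= n)%N ->
  holonomy (gface g i) j = if j == 0%N then holonomy g n.+1 else holonomy g j.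
Proof.
move=> ni nj; rewrite /holonomy !size_tuple.
have -> : prefix_prod (gface g i) n.+1 = (nth 1 g n.+1 * prefix_prod g n.+1)%g.
  by rewrite prefix_prod_gface_last//= leqnn.
rewrite (prefix_prodS g n.+1); case: j nj => [|j] nj /=.
  by rewrite prefix_prod0 invg1 mul1g mulg1 !mulgA mulVg mul1g.
rewrite prefix_prod_gface_last//; last by lia.
by rewrite invgM !mulgA mulgVK.
Qed.

Lemma prefix_prod_cons_rot n (g : n.+1.-tuple G) i l : (i <= n)%N -> (l <= n.+1)%N ->
  prefix_prod (1%g :: rot i g) l.+1 = ((prefix_prod g i)^-1 *
    (if (l + i <= n)%N then prefix_prod g (l + i)
     else prefix_prod g n.+1 * prefix_prod g (l + i - n.+1)))%g.
Proof.
move=> ni; elim: l => [|l IH] ln.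
  by rewrite prefix_prodS prefix_prod0 /= mul1g add0n ni mulVg.
rewrite prefix_prodS IH ?(ltnW ln)// -[nth _ _ l.+1]/(nth 1%g (rot i g) l).
rewrite nth_rot_tuple//; have [lin|nli] := leqP (l + i) n.
  rewrite -mulgA -prefix_prodS addSn; case: ifP => // c.
  have -> : ((l + i).+1 = n.+1)%N by lia.
  by rewrite subnn prefix_prod0 mulg1.
rewrite ifF; last by lia.
by rewrite addSn subSn// (prefix_prodS g (l + i - n.+1)) !mulgA.
Qed.

Lemma prefix_prod_cons_rot_size n (g : n.+1.-tuple G) i : (i <= n)%N ->
  prefix_prod (1%g :: rot i g) n.+2
  = ((prefix_prod g i)^-1 * prefix_prod g n.+1 * prefix_prod g i)%g.
Proof.
move=> ni; rewrite prefix_prod_cons_rot// ifF; last by lia.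
by rewrite addnC addnK mulgA.
Qed.

Lemma holonomy_cons_rot n (g : n.+1.-tuple G) i l : (i <= n)%N -> (l <= n)%N ->
  holonomy (1%g :: rot i g) l.+1
  = holonomy g (if (l + i <= n)%N then l + i else l + i - n.+1)%N.
Proof.
move=> ni ln; rewrite /holonomy /= size_rot !size_tuple.
rewrite prefix_prod_cons_rot_size// prefix_prod_cons_rot ?(leqW ln)//.
by case: ifP => c; rewrite !invgM !invgK !mulgA ?(mulgVK, mulgK, mulVg, mul1g).
Qed.

Lemma conj_classJ (x y h : G) : conj_class x y -> conj_class x (h^-1 * y * h)%g.
Proof. by move=> [k ->]; exists (k * h)%g; rewrite invgM !mulgA. Qed.

Lemma conj_class_holonomy (x : G) g j :
  conj_class x (\prod_(h <- g) h)%g <-> conj_class x (holonomy g j).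
Proof.
rewrite -prefix_prod_size /holonomy; split=> [|xg]; first exact: conj_classJ.
by have := conj_classJ (prefix_prod g j)^-1%g xg; rewrite invgK !mulgA mulgV mul1g mulgK.
Qed.

Lemma conj_class_gface (x : G) n (g : n.+2.-tuple G) i :
  conj_class x (\prod_(h <- gface g i) h)%g <-> conj_class x (\prod_(h <- g) h)%g.
Proof.
rewrite (conj_class_holonomy _ _ 0); have [ni|ni] := leqP i n.
  by rewrite holonomy_gface// leq0n -conj_class_holonomy.
by rewrite holonomy_gface_last//= -conj_class_holonomy.
Qed.

Lemma conj_class_cons_rot (x : G) n (g : n.+1.-tuple G) i : (i <= n)%N ->
  conj_class x (\prod_(h <- 1%g :: rot i g) h)%g <-> conj_class x (\prod_(h <- g) h)%g.
Proof.
move=> ni; apply: (iff_trans (conj_class_holonomy x _ 1)).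
by rewrite holonomy_cons_rot// add0n ni -conj_class_holonomy.
Qed.

End GroupTuples.

Section Untwisting.
Variables (R : realType) (G : groupType) (w : normalized_cocycle R G) (x : G).
Hypothesis finite_centralizer : finite_set (centralizer x).

Definition untwist_factor (t : R) (g : seq G) (j : nat) : R[i] :=
  cexp (t%:C * orbit_primitive w x (nth 1%g g j) (holonomy g j)).

(** The factor of a product differs from the product of the factors exactly by
    the twist of the multiplication. *)
Lemma untwist_factor_merge t g h y : conj_class x y ->
  cexp (t%:C * orbit_primitive w x (g * h)%g y) * cocycle_exp w t g h
  = cexp (t%:C * orbit_primitive w x g y)
    * cexp (t%:C * orbit_primitive w x h (g^-1 * y * g)%g).
Proof.
move=> xy; rewrite /cocycle_exp -!cexpD -mulrDr.
by rewrite orbit_primitiveM// mulrDr.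
Qed.

(** The cocycle identity telescopes along the prefix products: after m factors
    the product of the w-terms is short of the product of the untwisting
    factors by exp (t mu(g_0 ... g_(m-1), y)), and for the full product y this
    missing factor is exp (t mu(y, y)) = exp (t xi y). *)
Lemma twist_weightE (conjugator : G -> G)
    (conjugatorP : forall y, conj_class x y ->
       ((conjugator y)^-1 * x * conjugator y)%g = y) t n (g : n.+1.-tuple G) :
  conj_class x (\prod_(h <- g) h)%g ->
  twist_weight w x conjugator t g = \prod_(j < n.+1) untwist_factor t g j.
Proof.
move=> xg; rewrite -(big_mkord xpredT (untwist_factor t g)).
set y := (\prod_(h <- g) h)%g in xg *.
have yE : y = prefix_prod g (size g) by rewrite prefix_prod_size.
(* The factor i = 0 of the product is 1; including it makes the induction on m
   start from an empty product. *)
have main m : (m <= n.+1)%N ->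
    (\prod_(0 <= i < m) cocycle_exp w t (prefix_prod g i) (nth 1%g g i))
      * cexp (t%:C * orbit_primitive w x (prefix_prod g m) y)
    = \prod_(0 <= j < m) untwist_factor t g j.
  elim: m => [|m IH] mn.
    by rewrite !big_nil prefix_prod0 orbit_primitive1 mulr0 cexp0 mulr1.
  rewrite !big_nat_recr//= -(IH (ltnW mn)) -mulrA -[RHS]mulrA; congr (_ * _).
  rewrite mulrC prefix_prodS untwist_factor_merge//.
  by rewrite /untwist_factor /holonomy -yE.
rewrite -(main n.+1 (leqnn _)) big_nat_recl// prefix_prod0.
have -> : cocycle_exp w t 1%g (nth 1%g g 0) = 1.
  by rewrite /cocycle_exp (cocycle1g (cocycle_axiom w)) mulr0 cexp0.
rewrite mul1r /twist_weight -/y.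
have -> : prefix_prod g n.+1 = y by rewrite yE size_tuple.
rewrite (orbit_primitive_diag _ finite_centralizer conjugatorP)//.
rewrite big_add1 /=; congr (_ * _); apply: eq_big_nat => i /andP[_ ni].
by rewrite prefix_prod_take// size_tuple; lia.
Qed.

Variables (A : algType R[i]) (gr : grading G A).

(** The map which identifies the twisted tuples over the class of x with tuples
    over A. It is not induced by a map of algebras: the factor of an entry
    depends on its degree and on the holonomy at its slot. *)
Definition untwist t n (g : seq G) (a : n.-tuple A) : n.-tuple A :=
  [tuple untwist_factor t g j *: tnth a j | j < n].

Lemma nth_untwist t n g (a : n.-tuple A) j :
  (untwist t g a)`_j = untwist_factor t g j *: a`_j.
Proof.
have [jn|nj] := ltnP j n; first by rewrite nth_mktuple_lt (tnth_nth 0).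
by rewrite !nth_default ?size_tuple// scaler0.
Qed.

(** A face keeps the holonomy at the slots it does not touch and merges two
    adjacent ones, where untwist_factor_merge applies. *)
Lemma untwist_face t n (g : n.+2.-tuple G) (a : n.+2.-tuple (twisted gr w t)) i :
  (forall j, gr (tnth g j) (tnth a j)) -> conj_class x (\prod_(h <- g) h)%g ->
  untwist t (gface g i) (face a i : n.+1.-tuple (twisted gr w t))
  = face (untwist t g (a : n.+2.-tuple A)) i.
Proof.
move=> ga xg; apply: tuple_nthP => j jn.
have gra k : (k < n.+2)%N -> gr (nth 1%g g k) (a`_k : A).
  by move=> kn; have := ga (Ordinal kn); rewrite (tnth_nth 1%g) (tnth_nth 0).
have xhol k : conj_class x (holonomy g k) by apply/conj_class_holonomy.
have mergeE k l : (k < n.+2)%N -> (l < n.+2)%N ->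
    holonomy g l = ((nth 1 g k)^-1 * holonomy g k * nth 1 g k)%g ->
    cexp (t%:C * orbit_primitive w x (nth 1 g k * nth 1 g l)%g (holonomy g k))
      *: ((a`_k : twisted gr w t) * (a`_l : twisted gr w t) : A)
    = (untwist_factor t g k *: (a`_k : A)) * (untwist_factor t g l *: (a`_l : A)).
  move=> kn ln hl.
  rewrite [(a`_k : twisted gr w t) * _](twisted_mul_homog _ _ (gra k kn) (gra l ln)).
  rewrite scalerA untwist_factor_merge// -hl.
  by rewrite -scalerAl -scalerAr scalerA.
rewrite nth_untwist.
have := @nth_face _ (twisted gr w t) n a i j jn.
move=> /(congr1 (fun u : A => untwist_factor t (gface g i) j *: u)) aE.
apply: (etrans aE) => {aE}.
rewrite nth_face// !nth_untwist {1}/untwist_factor nth_gface//.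
have [ni|ni] := leqP i n.
  rewrite holonomy_gface//.
  have [ji|ij|->] := ltngtP j i; [reflexivity|reflexivity|].
  by apply: mergeE; rewrite ?holonomyS//; lia.
rewrite holonomy_gface_last//; have [_|_] := eqVneq j 0%N; last by reflexivity.
apply: mergeE => //; rewrite /holonomy prefix_prod0 size_tuple (prefix_prodS g n.+1).
by rewrite invg1 mul1g mulg1 !mulgA mulgVK mulVg mul1g.
Qed.

(** Rotation permutes the holonomies, and a unit inserted in front has degree 1,
    hence factor 1. *)
Lemma untwist_cons_rot t n (g a : n.+1.-tuple _) i : (i <= n)%N ->
  untwist t (1%g :: rot i g) [tuple of (1 : A) :: rot i a]
  = [tuple of 1 :: rot i (untwist t g a)].
Proof.
move=> ni; apply: tuple_nthP => j jn; rewrite nth_untwist !nth_cons_rot//.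
case: j jn => [|j] jn.
  by rewrite /untwist_factor /= orbit_primitive1 mulr0 cexp0 scale1r.
rewrite nth_untwist; congr (_ *: _); rewrite /untwist_factor.
by rewrite holonomy_cons_rot//= nth_rot_tuple.
Qed.

End Untwisting.

(** * Functionals on smooth sections *)

Section Sections.
Variables (R : realType) (G : groupType) (w : normalized_cocycle R G) (x : G).
Variables (A : algType R[i]) (gr : grading G A).
Local Notation I := (unit_interval R).
Local Notation Gamma := (smooth_sections gr w).
Local Notation comp := Defs.comp.

Lemma finite_tuples (S : set G) m : finite_set S ->
  finite_set [set g : m.-tuple G | forall j, S (tnth g j)].
Proof.
move=> /finite_seqP[s sE].
pose val_tuple (f : {ffun 'I_m -> seq_sub s}) := [tuple val (f j) | j < m].
apply: (@sub_finite_set _ _ (val_tuple @` [set: _])).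
  move=> g Sg; have gs j : tnth g j \in s by have := Sg j; rewrite sE.
  exists [ffun j => SeqSub (gs j)] => //.
  by apply: eq_from_tnth => j; rewrite tnth_mktuple ffunE.
apply: finite_image; by apply: (@sub_finite_set _ _ [set` xpredT]).
Qed.

Definition slot_value n (tau : 'I_n -> I) (g : n.-tuple G) (f : n.-tuple Gamma)
    (j : 'I_n) : A :=
  untwist_factor w x (val (tau j)) g j
    *: comp gr (section_fun (tnth f j) (tau j)) (tnth g j).

(** The functional F at the untwisted tuple of the values of f, where slot j is
    evaluated at its own time tau j, restricted to the part of f whose total
    degree is conjugate to x. Separate times for the slots allow F_1(s) and
    F_0(t), F_2(t), ... in one term. *)
Definition localized n (F : n.+1.-tuple A -> R[i]) (tau : 'I_n.+1 -> I)
    (f : n.+1.-tuple Gamma) : R[i] :=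
  \sum_(g \in [set g : n.+1.-tuple G | conj_class x (\prod_(h <- g) h)%g])
    F [tuple slot_value tau g f j | j < n.+1].

(** Only degrees occurring in the entries at hand contribute, so the sums over
    all degrees can be restricted to one common finite set. *)
Lemma multilinear_localized n (F : n.+1.-tuple A -> R[i]) tau :
  multilinear F -> multilinear (localized F tau).
Proof.
move=> FP k f i a b; rewrite /localized.
set Y := [set g : n.+1.-tuple G | _].
pose supp (u : Gamma) j := [set h | comp gr (section_fun u (tau j)) h != 0].
pose S := \bigcup_(j in [set: 'I_n.+1]) (supp (tnth f j) j `|` supp a j `|` supp b j).
have fS : finite_set S.
  apply: bigcup_finite => [|j _].
    by apply: (@sub_finite_set _ _ [set` xpredT]).
  by rewrite !finite_setU; split; [split|]; exact: comp_finite.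
pose D := Y `&` [set g : n.+1.-tuple G | forall j, S (tnth g j)].
have fD : finite_set D.
  by apply: (@sub_finite_set _ _ _ (@subIsetr _ _ _)); exact: finite_tuples.
(* The set S contains the degrees of a and of b, hence those of k a + b, so one
   finite D serves all three. *)
have red (u : Gamma) : (forall h, comp gr (section_fun u (tau i)) h != 0 -> S h) ->
    \sum_(g \in Y) F [tuple slot_value tau g (subst_tuple f i u) j | j < n.+1]
    = \sum_(g \in D) F [tuple slot_value tau g (subst_tuple f i u) j | j < n.+1].
  move=> uS; apply/esym/fsbig_widen; first exact: subIsetl.
  move=> g [Yg nD] /=; have [j nS] : exists j, ~ S (tnth g j).
    by apply/existsNP => Sg; apply: nD; split.
  apply: (multilinear_eq0 (i := j)) => //.
  rewrite tnth_mktuple /slot_value tnth_mktuple.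
  case: eqP => [ji|ji].
    rewrite ji in nS *.
    have [->|uj] := eqVneq (comp gr (section_fun u (tau i)) (tnth g i)) 0.
      by rewrite scaler0.
    by case: nS; exact: uS.
  have [->|cn0] := eqVneq (comp gr (section_fun (tnth f j) (tau j)) (tnth g j)) 0.
    by rewrite scaler0.
  by case: nS; exists j => //; left; left.
rewrite !red.
- rewrite mulr_fsumr -fsbig_split//=; apply: eq_fsbigr => g _.
  set y := [tuple slot_value tau g f j | j < n.+1].
  have yE u : [tuple slot_value tau g (subst_tuple f i u) j | j < n.+1]
      = subst_tuple y i (untwist_factor w x (val (tau i)) g i
          *: comp gr (section_fun u (tau i)) (tnth g i)).
    apply: eq_from_tnth => j; rewrite !tnth_mktuple /slot_value tnth_mktuple.
    by case: eqP => [->|].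
  rewrite !yE -FP; congr (F (subst_tuple y i _)).
  have -> : section_fun (k *: a + b) (tau i)
    = k *: section_fun a (tau i) + section_fun b (tau i) by [].
  by rewrite compP scalerDr !scalerA [_ * k]mulrC.
- by move=> h bh; exists i => //; right.
- by move=> h ah; exists i => //; left; right.
- move=> h; have -> : section_fun (k *: a + b) (tau i)
    = k *: section_fun a (tau i) + section_fun b (tau i) by [].
  rewrite compP => abh; exists i => //.
  have [ah|ah] := eqVneq (comp gr (section_fun a (tau i)) h) 0.
    by right; move: abh; rewrite ah scaler0 add0r.
  by left; right.
Qed.

Definition homogeneous n (g : n.-tuple G) (f : n.-tuple Gamma) :=
  forall j t, gr (tnth g j) (section_fun (tnth f j) t).

Lemma localized_homogeneous n (F : n.+1.-tuple A -> R[i]) tau g f :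
  multilinear F -> homogeneous g f -> localized F tau f =
  if `[< conj_class x (\prod_(h <- g) h)%g >]
  then F [tuple untwist_factor w x (val (tau j)) g j *: (section_fun (tnth f j) (tau j) : A)
          | j < n.+1]
  else 0.
Proof.
move=> FP gf.
have zero h : h <> g -> F [tuple slot_value tau h f j | j < n.+1] = 0.
  move=> hg; have /existsP[i hi] : [exists i, tnth h i != tnth g i].
    apply: contra_notT hg => /existsPn e; apply: eq_from_tnth => i.
    by apply/eqP/negPn/e.
  apply: (multilinear_eq0 (i := i)) => //.
  by rewrite tnth_mktuple /slot_value (comp_homog (gf i _)) (negbTE hi) scaler0.
rewrite /localized; case: asboolP => gx; last first.
  by rewrite fsbig1// => h /= hx; apply: zero => hg; apply: gx; rewrite -hg.
rewrite -(@fsbig_widen _ _ _ _ [set g]) ?fsbig_set1; last 2 first.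
- by move=> _ ->.
- by move=> h [_ hg]; exact: zero.
congr F; apply: eq_from_tnth => i.
by rewrite !tnth_mktuple /slot_value (comp_homog (gf i _)) eqxx.
Qed.

Definition monomial (f : Gamma) := exists g c (v : A),
  [/\ smooth_on_I c, gr g v & forall t, section_fun f t = c t *: v].

(** A section is a finite sum of smooth functions times vectors, and a vector is
    a sum of homogeneous ones. *)
Lemma section_ind (P : Gamma -> Prop) : P 0 ->
  (forall f f', P f -> P f' -> P (f + f')) -> (forall f, monomial f -> P f) ->
  forall f, P f.
Proof.
move=> P0 PD Pm [f sf].
suff [sf' Pf] : exists sf', P (SmoothSections (section_fun := f) sf').
  by rewrite (bool_irrelevance sf sf').
move: f sf; apply: smooth_section_ind => [|f f' [sf Pf] [sf' Pf']|c v sc].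
- exists (smooth_section0 gr w); rewrite (_ : SmoothSections _ = 0)//.
  exact: val_inj.
- exists (smooth_sectionD sf sf').
  rewrite (_ : SmoothSections _ = SmoothSections sf + SmoothSections sf'); first exact: PD.
  exact: val_inj.
exists (smooth_section_cst gr w v sc).
elim/(homog_ind (gr := gr)): v => [|v v' Pv Pv'|g v gv].
- rewrite (_ : SmoothSections _ = 0)//; apply: val_inj; apply/funext => t.
  exact: scaler0.
- rewrite (_ : SmoothSections _ = SmoothSections (smooth_section_cst gr w v sc)
    + SmoothSections (smooth_section_cst gr w v' sc)); first exact: PD.
  by apply: val_inj; apply/funext => t; exact: scalerDr.
by apply: Pm; exists g, c, v.
Qed.

(** An error estimate for multilinear functionals can be checked on tuples of
    scalar functions times homogeneous vectors, since these span and the sums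
    are finite. The functions c are indexed by all naturals, so that faces and
    products may refer to them without bounds. *)
Lemma quadratic_multilinear n (H : I -> I -> n.+1.-tuple Gamma -> R[i]) :
  (forall s t, multilinear (H s t)) ->
  (forall (g : n.+1.-tuple G) (c : nat -> I -> R[i]) (v : n.+1.-tuple A)
      (f : n.+1.-tuple Gamma),
    (forall j, smooth_on_I (c j)) -> (forall j, gr (tnth g j) (tnth v j)) ->
    (forall (j : 'I_n.+1) t, section_fun (tnth f j) t = c j t *: tnth v j) ->
    quadratic (fun s t => H s t f)) ->
  forall f, quadratic (fun s t => H s t f).
Proof.
move=> HP Hm; apply: (slot_ind (S := monomial)) => [f mf|f i mf].
  have /choice[d dP] : forall j : 'I_n.+1, exists d : G * (I -> R[i]) * A,
      [/\ smooth_on_I d.1.2, gr d.1.1 d.2 &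
        forall t, section_fun (tnth f j) t = d.1.2 t *: d.2].
    by move=> j; have [g [c [v]]] := mf j; exists (g, c, v).
  apply: (Hm [tuple (d j).1.1 | j < n.+1] (fun j => (d (inord j)).1.2)
    [tuple (d j).2 | j < n.+1] f).
  - by move=> j; have [] := dP (inord j).
  - by move=> j; rewrite !tnth_mktuple; have [] := dP j.
  - by move=> j t; rewrite tnth_mktuple inord_val; have [_ _] := dP j; exact.
apply: section_ind => //.
- have := quadratic0 R; congr quadratic; apply/funext => s; apply/funext => t.
  by rewrite (multilinear_eq0 (i := i))// tnth_mktuple eqxx.
- move=> a b qa qb; have := quadraticD qa qb; congr quadratic.
  apply/funext => s; apply/funext => t.
  by rewrite -[a]scale1r HP mul1r scale1r.
Qed.

End Sections.

(** * The transgression cochain *)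

Section Transgression.
Variables (R : realType) (G : groupType) (w : normalized_cocycle R G) (x : G).
Hypothesis finite_centralizer : finite_set (centralizer x).
Variables (A : algType R[i]) (gr : grading G A).
Local Notation I := (unit_interval R).
Local Notation Gamma := (smooth_sections gr w).
Local Notation At t := (twisted gr w (val t)).
Local Notation comp := Defs.comp.
Variables (n : nat) (phi : n.+1.-tuple A -> R[i]).
Hypothesis phi_cyclic : is_cyclic_cocycle phi.

Let phiP : multilinear phi := cochainP (cyclic_cochain phi_cyclic).

Definition slot1_time (s t : I) m (j : 'I_m) : I := if j == 1%N :> nat then s else t.

(** The finite-difference version of the contraction of phi with d/dt:
    phi (F_0(t) (F_1(s) - F_1(t)), F_2(t), ..., F_(n+1)(t)). *)
Definition transgression (s t : I) (f : n.+2.-tuple Gamma) : R[i] :=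
  localized x (fun a => phi (face a 0)) (@slot1_time s t n.+2) f
  - localized x (fun a => phi (face a 0)) (fun=> t) f.

Definition section_values t m (f : m.-tuple Gamma) : m.-tuple A :=
  [tuple (section_fun (tnth f j) t : A) | j < m].

Lemma nth_values t m (f : m.-tuple Gamma) j :
  (section_values t f)`_j = section_fun f`_j t.
Proof.
have [jm|mj] := ltnP j m; first by rewrite nth_mktuple_lt (tnth_nth 0).
by rewrite !nth_default ?size_tuple.
Qed.

Lemma values_cons_rot t m (f : m.-tuple Gamma) i :
  section_values t [tuple of 1 :: rot i f] = [tuple of (1 : A) :: rot i (section_values t f)].
Proof.
have valuesE k (h : k.-tuple Gamma) :
    val (section_values t h) = [seq (section_fun u t : A) | u <- h].
  have -> : section_values t h = map_tuple (fun u => section_fun u t : A) h => [|//].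
  by apply: eq_from_tnth => j; rewrite tnth_mktuple tnth_map.
by apply: val_inj; rewrite valuesE /= map_rot -valuesE.
Qed.

Lemma multilinear_transgression s t : multilinear (transgression s t).
Proof.
have fP := multilinear_face 0 phiP.
move=> k f i a b.
by rewrite /transgression !(multilinear_localized _ _ fP); ring.
Qed.

(** A unit in slot 1 is constant in time and has untwisting factor 1, so its
    increment vanishes; a unit in a later slot stays, one slot earlier, among
    the arguments of phi. *)
Lemma cochain_transgression s t : is_cochain (transgression s t).
Proof.
split=> [|f i i0 fi]; first exact: multilinear_transgression.
have one h (u : I) : comp gr (section_fun (1 : Gamma) u) h = if h == 1%g then 1 else 0.
  by rewrite (comp_homog (grading1 (grading_axiom gr))).
rewrite /transgression /localized; apply/eqP; rewrite subr_eq0; apply/eqP.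
apply: eq_fsbigr => g _.
have [gi|gi] := eqVneq (tnth g i) 1%g; last first.
  rewrite !(multilinear_eq0 (i := i) (multilinear_face 0 phiP))//.
    by rewrite tnth_mktuple /slot_value fi one (negbTE gi) scaler0.
  by rewrite tnth_mktuple /slot_value fi one (negbTE gi) scaler0.
have slot1 tau : slot_value x tau g f i = 1.
  rewrite /slot_value fi one gi eqxx /untwist_factor.
  by rewrite -[nth _ _ _](tnth_nth 1%g g i) gi orbit_primitive1 mulr0 cexp0 scale1r.
(* Slot 1 is the only one evaluated at the time s. *)
have [i1|i1] := eqVneq (i : nat) 1%N.
  congr (phi (face _ 0)); apply: eq_from_tnth => j; rewrite !tnth_mktuple.
  have [j1|j1] := eqVneq (j : nat) 1%N.
    have -> : j = i by apply: val_inj; rewrite /= j1 i1.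
    by rewrite !slot1.
  by rewrite /slot_value /slot1_time (negbTE j1).
have i2 : (1 < i)%N by move: i0 i1; rewrite -val_eqE /= => i0 i1; lia.
have im : (i.-1 < n.+1)%N by have := ltn_ord i; lia.
have vanish tau : phi (face [tuple slot_value x tau g f j | j < n.+2] 0) = 0.
  apply: (cochain_degenerate (cyclic_cochain phi_cyclic) (i := Ordinal im)).
    by rewrite -val_eqE /=; lia.
  rewrite (tnth_nth 0) nth_face// leq0n ltn0 ifF; last by apply/eqP => /=; lia.
  have -> : (Ordinal im).+1 = i by rewrite /= prednK ?(ltnW i2).
  by rewrite -tnth_nth tnth_mktuple slot1.
by rewrite !vanish.
Qed.

Lemma localized_constant t m (F : m.+1.-tuple A -> R[i]) g (f : m.+1.-tuple Gamma) :
  multilinear F -> homogeneous g f -> localized x F (fun=> t) f =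
  if `[< conj_class x (\prod_(h <- g) h)%g >]
  then F (untwist w x (val t) g (section_values t f)) else 0.
Proof.
move=> FP gf; rewrite (localized_homogeneous _ _ FP gf); case: asboolP => // _.
by congr F; apply: eq_from_tnth => j; rewrite !tnth_mktuple.
Qed.

Lemma transgression_homogeneous s t g (f : n.+2.-tuple Gamma) : homogeneous g f ->
  transgression s t f = if `[< conj_class x (\prod_(h <- g) h)%g >]
  then insertion_defect phi (untwist w x (val t) g (section_values t f))
         (untwist w x (val s) g (section_values s f)) else 0.
Proof.
move=> gf; have fP := multilinear_face 0 phiP.
rewrite /transgression (localized_constant _ fP gf) (localized_homogeneous _ _ fP gf).
case: asboolP => _; last by rewrite subrr.
rewrite /insertion_defect; congr (phi (face _ 0) - _).
apply: eq_from_tnth => j; rewrite !tnth_mktuple /slot1_time.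
by case: eqP.
Qed.

Lemma homogeneous_face m (g : m.+2.-tuple G) (f : m.+2.-tuple Gamma) i :
  homogeneous g f -> homogeneous (gface g i) (face f i).
Proof.
move=> gf j t; have gfk k : (k < m.+2)%N -> gr (nth 1%g g k) (section_fun f`_k t).
  by move=> km; have := gf (Ordinal km) t; rewrite (tnth_nth 1%g) (tnth_nth 0).
have gfM k l : (k < m.+2)%N -> (l < m.+2)%N ->
    gr (nth 1 g k * nth 1 g l)%g (section_fun (f`_k * f`_l) t).
  move=> km lm.
  have -> : section_fun (f`_k * f`_l) t
    = twisted_mul gr w (val t) (section_fun f`_k t) (section_fun f`_l t) by [].
  rewrite (twisted_mul_homog _ _ (gfk k km) (gfk l lm)) -[_ *: _]addr0.
  have M := gradingM (grading_axiom gr) (gfk k km) (gfk l lm).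
  exact: (gradingP (grading_axiom gr) _ M (grading0 (grading_axiom gr) _)).
rewrite (tnth_nth 1%g) (tnth_nth 0) nth_face// nth_gface//.
have jm := ltn_ord j.
case: ifP => im; last by case: ifP => _; [apply: gfM|apply: gfk]; lia.
case: ifP => ji; first by apply: gfk; lia.
by case: ifP => _; [apply: gfM|apply: gfk]; lia.
Qed.

Lemma homogeneous_cons_rot m (g : m.+1.-tuple G) (f : m.+1.-tuple Gamma) i :
  (i <= m)%N -> homogeneous g f ->
  homogeneous [tuple of 1%g :: rot i g] [tuple of 1 :: rot i f].
Proof.
move=> im gf j t; rewrite (tnth_nth 1%g) (tnth_nth 0) nth_cons_rot//.
case: j => -[|j] jm /=; first exact: grading1 (grading_axiom gr).
rewrite nth_rot_tuple//; set k := (if _ then _ else _).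
have km : (k < m.+1)%N by rewrite /k; case: ifP; lia.
by have := gf (Ordinal km) t; rewrite (tnth_nth 1%g) (tnth_nth 0).
Qed.

Lemma untwist_values_face t m (g : m.+2.-tuple G) (f : m.+2.-tuple Gamma) i :
  homogeneous g f -> conj_class x (\prod_(h <- g) h)%g ->
  untwist w x (val t) (gface g i) (section_values t (face f i))
  = face (untwist w x (val t) g (section_values t f)) i.
Proof.
move=> gf xg; rewrite -(untwist_face finite_centralizer (gr := gr))//; last first.
  by move=> j; rewrite tnth_mktuple; exact: gf.
congr untwist; apply: eq_from_tnth => j.
rewrite tnth_mktuple !(tnth_nth 0).
have -> : (face f i)`_j = if (i <= m)%N then
      if (j < i)%N then f`_j else if j == i :> nat then f`_j * f`_j.+1 else f`_j.+1
    else if j == 0%N :> nat then f`_m.+1 * f`_0 else f`_j by exact: nth_face.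
apply/esym; apply: (etrans (@nth_face _ (At t) _ (section_values t f) i j (ltn_ord j))).
have v k := nth_values t f k.
do ![case: ifP => _]; rewrite ?[nth _ (section_values t f) _]v //.
Qed.

Section Monomial.
Variables (m : nat) (g : m.-tuple G) (c : nat -> I -> R[i]) (v : m.-tuple A).
Variable f : m.-tuple Gamma.
Hypothesis c_smooth : forall j, smooth_on_I (c j).
Hypothesis gv : forall j, gr (tnth g j) (tnth v j).
Hypothesis fE : forall (j : 'I_m) t, section_fun (tnth f j) t = c j t *: tnth v j.

Definition untwisted_coef j (t : I) : R[i] := untwist_factor w x (val t) g j * c j t.

Lemma smooth_untwisted_coef j : smooth_on_I (untwisted_coef j).
Proof. by apply: smooth_on_IM => //; exact: smooth_on_I_cexp. Qed.

Lemma homogeneous_monomial : homogeneous g f.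
Proof.
move=> j t; rewrite fE -[_ *: _]addr0.
exact: (gradingP (grading_axiom gr) _ (gv j) (grading0 (grading_axiom gr) _)).
Qed.

Lemma untwist_monomial t :
  untwist w x (val t) g (section_values t f) = [tuple untwisted_coef j t *: tnth v j | j < m].
Proof.
by apply: eq_from_tnth => j; rewrite !tnth_mktuple fE scalerA.
Qed.

End Monomial.

(** By insertion_defect_b the boundary is a multiple of the product of the
    increments of the first two coefficients. *)
Lemma quadratic_transgression_b (f : n.+3.-tuple Gamma) :
  quadratic (fun s t => pairing (transgression s t) (b_tensor f)).
Proof.
apply: (quadratic_multilinear
  (H := fun s t f => pairing (transgression s t) (b_tensor f))) => [s t|].
  exact/multilinear_pairing_b/multilinear_transgression.
move=> g c v {}f sc gv fE; have gf := homogeneous_monomial gv fE.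
have bE s t : pairing (transgression s t) (b_tensor f) =
    if `[< conj_class x (\prod_(h <- g) h)%g >] then
      \sum_(i <- iota 0 n.+3) (-1) ^+ i * insertion_defect phi
        (face (untwist w x (val t) g (section_values t f)) i)
        (face (untwist w x (val s) g (section_values s f)) i)
    else 0.
  rewrite /pairing big_map; case: asboolP => xg.
    apply: eq_bigr => i _; rewrite (transgression_homogeneous _ _ (homogeneous_face i gf)).
    rewrite asboolT; last exact/conj_class_gface.
    by rewrite !untwist_values_face.
  apply: big1 => i _; rewrite (transgression_homogeneous _ _ (homogeneous_face i gf)).
  by rewrite asboolF ?mulr0// => /conj_class_gface.
under eq_fun do under eq_fun do rewrite bE.
case: asboolP => xg; last exact: quadratic0.
(* The entries of the result are those of (v_0 v_1 v_2, v_3, ...), of which slot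
   0 has its scalars l_0 (l_1(s) - l_1(t)) (l_2(s) - l_2(t)) pulled out. *)
pose l := untwisted_coef g c; have sl := smooth_untwisted_coef g sc.
pose u := subst_tuple (face (face v 0) 0) ord0 (v`_0 * v`_1 * v`_2).
pose q (j : 'I_n.+1) (t : I) : R[i] := if j == ord0 then 1 else l j.+2 t.
have sq j : smooth_on_I (q j).
  by rewrite /q; case: (j == ord0); [exact: smooth_on_I_cst|exact: sl].
have q1 := quadratic_diffM (sl 1%N) (sl 2%N).
have q2 := quadraticMl (smooth_on_IM (sl 0%N) (smooth_on_I_prod (index_enum 'I_n.+1) sq)) q1.
have := quadraticZ (- phi u) q2; congr quadratic.
apply/funext => s; apply/funext => t.
rewrite (insertion_defect_b _ _ phiP (cyclic_closed phi_cyclic)).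
have aE (t' : I) j : (untwist w x (val t') g (section_values t' f))`_j = l j t' *: v`_j.
  have [jn|nj] := ltnP j n.+3; last by rewrite !nth_default ?size_tuple// scaler0.
  by rewrite (untwist_monomial g fE) nth_mktuple_lt (tnth_nth 0).
pose k := l 0%N t * (l 1%N s - l 1%N t) * (l 2%N s - l 2%N t).
pose y := [tuple q j t *: tnth u j | j < n.+1].
rewrite !aE -!scalerBl.
have -> : subst_tuple (face (face (untwist w x (val t) g (section_values t f)) 0) 0) ord0
    ((l 0%N t *: v`_0) * ((l 1%N s - l 1%N t) *: v`_1) * ((l 2%N s - l 2%N t) *: v`_2))
  = subst_tuple y ord0 (k *: (v`_0 * v`_1 * v`_2) + 0).
  apply: tuple_nthP => j jn; rewrite !nth_subst addr0.
  have [_|j0] := eqVneq j 0%N.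
    by rewrite /k -!scalerAl -!scalerAr -!scalerAl !scalerA mulrAC.
  have -> : y`_j = l j.+2 t *: u`_j.
    rewrite nth_mktuple_lt (tnth_nth 0) /q; case: eqP => // /(congr1 val) /= j0'.
    by rewrite j0' in j0.
  by rewrite /u nth_subst (negbTE j0); case: j jn j0 => // j _ _; rewrite !nth_face0S aE.
have y0 : subst_tuple y ord0 (v`_0 * v`_1 * v`_2) = y.
  apply: eq_from_tnth => j; rewrite !tnth_mktuple; case: eqP => // ->.
  by rewrite /q eqxx scale1r.
rewrite phiP (@multilinear_eq0 _ _ _ _ (subst_tuple y ord0 0) ord0 phiP);
  last by rewrite tnth_mktuple eqxx.
by rewrite y0 (multilinear_scale _ _ phiP) addr0 /k /l; ring.
Qed.

(** By insertion_defect_B the left-hand term is the sum over the slots of the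
    increments of phi in one slot, and the bracket is the total increment. *)
Lemma quadratic_transgression_B (f : n.+1.-tuple Gamma) :
  quadratic (fun s t => pairing (transgression s t) (B_tensor f)
    - (localized x phi (fun=> s) f - localized x phi (fun=> t) f)).
Proof.
apply: (quadratic_multilinear
  (H := fun s t f => pairing (transgression s t) (B_tensor f)
    - (localized x phi (fun=> s) f - localized x phi (fun=> t) f))) => [s t|].
  have mB := multilinear_pairing_B (multilinear_transgression s t).
  have ml tau := multilinear_localized x tau phiP.
  by move=> k f' i a b; rewrite mB !ml; ring.
move=> g c v {}f sc gv fE; have gf := homogeneous_monomial gv fE.
have BE s t : pairing (transgression s t) (B_tensor f) =
    if `[< conj_class x (\prod_(h <- g) h)%g >] then
      \sum_(i < n.+1) (phi (subst_tuple (untwist w x (val t) g (section_values t f)) i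
          (tnth (untwist w x (val s) g (section_values s f)) i))
        - phi (untwist w x (val t) g (section_values t f)))
    else 0.
  rewrite /pairing big_map -[iota 0 n.+1]/(index_iota 0 n.+1) big_mkord.
  case: asboolP => xg; last first.
    apply: big1 => i _ /=; have ni : (i <= n)%N by rewrite -ltnS.
    rewrite (transgression_homogeneous _ _ (homogeneous_cons_rot ni gf)).
    by rewrite asboolF ?mulr0// => /(conj_class_cons_rot _ _ ni).
  apply: eq_bigr => i _ /=; have ni : (i <= n)%N by rewrite -ltnS.
  rewrite (transgression_homogeneous _ _ (homogeneous_cons_rot ni gf)).
  rewrite asboolT; last exact/conj_class_cons_rot.
  rewrite !values_cons_rot !untwist_cons_rot// (insertion_defect_B _ _ (ltn_ord i))//.
  rewrite mulrA -expr2 sqrr_sign mul1r.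
  by have -> : Ordinal (ltn_ord i) = i by exact: val_inj.
under eq_fun do under eq_fun do
  rewrite BE !(localized_constant _ phiP gf).
case: asboolP => xg; last first.
  by under eq_fun do under eq_fun do rewrite !subr0; exact: quadratic0.
pose l j := untwisted_coef g c j; have sl j := smooth_untwisted_coef g sc j.
have := quadraticZ (phi v) (quadratic_leibniz (fun i : 'I_n.+1 => sl i)).
congr quadratic; apply/funext => s; apply/funext => t.
rewrite !(untwist_monomial g fE).
have substE (i : 'I_n.+1) :
    phi (subst_tuple [tuple untwisted_coef g c j t *: tnth v j | j < n.+1] i
      (tnth [tuple untwisted_coef g c j s *: tnth v j | j < n.+1] i))
    = untwisted_coef g c i s * (\prod_(j < n.+1 | j != i) untwisted_coef g c j t) * phi v.
  have -> : subst_tuple [tuple untwisted_coef g c j t *: tnth v j | j < n.+1] i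
      (tnth [tuple untwisted_coef g c j s *: tnth v j | j < n.+1] i)
    = [tuple (if j == i then untwisted_coef g c i s else untwisted_coef g c j t)
        *: tnth v j | j < n.+1].
    apply: eq_from_tnth => j; rewrite !tnth_mktuple.
    by case: eqP => [->|].
  rewrite multilinear_scale// (bigD1 i)//= eqxx; congr (_ * _ * _).
  by apply: eq_bigr => j /negbTE ->.
rewrite mulrBr mulr_sumr !(multilinear_scale _ _ phiP) -mulrBl mulrC [in RHS]mulrC.
congr (_ - _); rewrite -/l; apply: eq_bigr => i _.
have -> : \prod_(j < n.+1) untwisted_coef g c j t
  = untwisted_coef g c i t * \prod_(j < n.+1 | j != i) untwisted_coef g c j t by rewrite (bigD1 i).
rewrite substE; ring.
Qed.

Lemma pairing_twisted_cochain (conjugator : G -> G)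
    (conjugatorP : forall y, conj_class x y ->
       ((conjugator y)^-1 * x * conjugator y)%g = y) t (c : chain Gamma n) :
  pairing (twisted_cochain w x conjugator gr (val t) phi) (ev_chain t c)
  = pairing (localized x phi (fun=> t)) c.
Proof.
rewrite /pairing /ev_chain big_map; apply: eq_bigr => p _; congr (_ * _).
rewrite /twisted_cochain /localized; apply: eq_fsbigr => g /set_mem /= xg.
rewrite (twist_weightE w finite_centralizer conjugatorP)// -(multilinear_scale _ _ phiP).
by congr phi; apply: eq_from_tnth => j; rewrite !tnth_mktuple tnth_map.
Qed.

End Transgression.

(** The increment of the pairing between two times is, up to second order, the
    pairing of the transgression with B c_n = b c_(n+2), which is of second order
    itself. *)
Theorem theorem3p4 (R : realType) (G : groupType) (w0 : normalized_cocycle R G)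
    (x : G) (finite_centralizer : finite_set (centralizer x))
    (conjugator : G -> G)
    (conjugatorP : forall y, conj_class x y ->
       ((conjugator y)^-1 * x * conjugator y)%g = y)
    (A : algType R[i]) (gr : grading G A)
    (n : nat) (phi : n.+1.-tuple A -> R[i])
    (phi_cyclic : is_cyclic_cocycle phi)
    (phi_supported : supported_on_class x gr phi)
    (c : forall k : nat, chain (smooth_sections gr w0) k)
    (c_cocycle : bB_cocycle c)
    (s t : unit_interval R) :
  pairing (twisted_cochain w0 x conjugator gr (val s) phi)
          (ev_chain s (c n))
  = pairing (twisted_cochain w0 x conjugator gr (val t) phi)
            (ev_chain t (c n)).
Proof.
rewrite !(pairing_twisted_cochain finite_centralizer phi_cyclic conjugatorP).
move: s t; apply: quadratic_constant.
(* B c_n and b c_(n+2) agree in the quotient on which cochains are defined. *)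
pose tr s t := transgression (w := w0) x (gr := gr) phi s t.
have bB s t : pairing (tr s t) (hochschild_b (c n.+2)) = pairing (tr s t) (connes_B (c n)).
  by apply: chain_eq_pairing (c_cocycle.2 n); exact: cochain_transgression.
have qb : quadratic (fun s t => pairing (tr s t) (hochschild_b (c n.+2))).
  under eq_fun do under eq_fun do rewrite pairing_linext.
  apply: quadratic_sum => p; apply: quadraticZ.
  exact: (quadratic_transgression_b finite_centralizer phi_cyclic p.2).
have qB : quadratic (fun s t => pairing (tr s t) (connes_B (c n))
    - (pairing (localized x phi (fun=> s)) (c n) - pairing (localized x phi (fun=> t)) (c n))).
  have := quadratic_sum (c n) (fun p => quadraticZ p.1
    (quadratic_transgression_B x phi_cyclic p.2)).
  congr quadratic; apply/funext => s; apply/funext => t.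
  rewrite pairing_linext /pairing -!sumrB; apply: eq_bigr => p _.
  by rewrite !mulrBr.
have := quadraticD qb (quadraticZ (-1) qB); congr quadratic.
by apply/funext => s; apply/funext => t; rewrite bB; ring.
Qed.
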